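(* Let $X(x)=Ax+f(x)$ be a $C^1$ vector field on $\mathbb R^d$ with $f(0)=0$, $Df(0)=0$, where, with respect to an orthogonal decomposition $\mathbb R^d=E^{ss}\oplus E^{cs}\oplus E^{cu}\oplus E^{uu}$ with $\dim E^{ss}=i-1$, $\dim E^{cs}=\dim E^{cu}=1$, $\dim E^{uu}=d-i-1$, $$Ax=(A^{ss}x^{ss},\lambda_i x^{cs},\lambda_{i+1}x^{cu},A^{uu}x^{uu}),\qquad x=(x^{ss},x^{cs},x^{cu},x^{uu}),$$ with $A^{ss}\in\mathrm{GL}(i-1,\mathbb R)$, $A^{uu}\in\mathrm{GL}(d-i-1,\mathbb R)$, and $\lambda_i<0<\lambda_{i+1}$. Then the extended rescaled Poincaré maps of $X$ over the singularity $0$ coincide with those of the linear vector field $Y(x)=Ax$; that is, for every $t$, every unit vector $u$ and every sufficiently small $y\perp Au$, the value $P^*(t,u,0,y)$ is the same for $X$ and for $Y$.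
   Context: $0$ is a hyperbolic singularity with Lyapunov exponents $\lambda_1\le\dots\le\lambda_i<0<\lambda_{i+1}\le\dots\le\lambda_d$ (real parts of eigenvalues of $A$); $A^{ss}$ carries $\lambda_1,\dots,\lambda_{i-1}$ and $A^{uu}$ carries $\lambda_{i+2},\dots,\lambda_d$. For a $C^1$ vector field $X$ on $\mathbb R^d$ with $X(0)=0$, $DX(0)$ invertible and flow $\phi_t$, and for $x\ne0$ near $0$, the rescaled Poincaré map on $\mathcal N_x=X(x)^\perp$ is $$\mathcal P^*_{t,x}(y)=\frac{\phi_{\tau+t}(x+\|X(x)\|y)-\phi_t(x)}{\|X(\phi_t(x))\|},$$ where $\tau=\tau(t,x,y)$ is the (small, continuous in $y$, $\tau(t,x,0)=0$) time correction for which the right-hand side is orthogonal to $X(\phi_t(x))$. The extended rescaled Poincaré map over the singularity, $P^*(t,u,0,y)$ with $u$ a unit vector and $y\perp DX(0)u$ small, is the limit of $\mathcal P^*_{t,su'}(y')$ as $s\to0^+$, $u'\to u$, $y'\to y$ with $u'$ unit and $y'\perp X(su')$; this limit exists. *)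

(* Defs.v *)
From HB Require Import structures.
From mathcomp Require Import all_boot all_order all_algebra.
From mathcomp Require Import complex.
From mathcomp Require Import all_classical all_reals all_analysis.

Set Implicit Arguments.
Unset Strict Implicit.
Unset Printing Implicit Defensive.

Import Order.TTheory GRing.Theory Num.Theory.
Import numFieldNormedType.Exports.

Local Open Scope classical_set_scope.
Local Open Scope ring_scope.

Section Euclidean.
Context {R : realType} {d : nat}.
Implicit Types x y : 'cV[R]_d.

Definition dot x y : R := (x^T *m y) 0 0.

(* The norm carried by the canonical structure on matrices is the sup norm;
   the rescaling in the Poincare maps uses the Euclidean one. *)
Definition enorm x : R := Num.sqrt (dot x x).

End Euclidean.

(* The columns of B are an orthonormal system: B is a linear isometry of R^n
   onto a subspace of R^m, and B^T gives the coordinates in that subspace. *)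
Definition orthonormal_frame {R : realType} {m n : nat} (B : 'M[R]_(m, n)) :
  Prop := B^T *m B = 1%:M.

(* The real parts of the complex eigenvalues of B, with multiplicity, are the
   entries of l; the freedom in ordering zs makes the order of l irrelevant. *)
Definition lyapunov_exponents {R : realType} {n : nat}
    (B : 'M[R]_n) (l : seq R) : Prop :=
  exists2 zs : seq (complex R),
    char_poly (map_mx (real_complex R) B) = \prod_(z <- zs) ('X - z%:P)
    & [seq complex.Re z | z <- zs] = l.

Section VectorFields.
Context {R : realType} {d : nat}.
Local Notation V := ('cV[R]_d).
Implicit Types (X : V -> V) (D : set (R * V)) (phi : R -> V -> V).

Definition C1 X : Prop :=
  (forall x, differentiable X x) /\ (forall v, continuous ('D_v X)).

(* phi is the maximal (not necessarily complete) flow of X, with domain D.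
   Outside D the values of phi carry no information. *)
Record flow_of X D phi : Prop := FlowOf {
  flow_open : open D ;
  flow_interval : forall x, is_interval [set t | D (t, x)] ;
  flow_start : forall x, D (0, x) /\ phi 0 x = x ;
  flow_derive : forall t x, D (t, x) ->
    is_derive t 1 (fun s => phi s x) (X (phi t x)) ;
  flow_maximal : forall (J : set R) (c : R -> V),
    open J -> is_interval J -> J 0 ->
    (forall s, J s -> is_derive s 1 c (X (c s))) ->
    forall s, J s -> D (s, c 0) /\ phi s (c 0) = c s
}.

Definition normal_ball X (x : V) (r : R) : set V :=
  [set y | dot y (X x) = 0 /\ enorm y < r].

(* tau is the time correction y |-> tau(t, x, y) on the ball of radius r of
   the normal space at x. *)
Definition time_correction X D phi (t : R) (x : V) (r : R) (tau : V -> R) :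
  Prop :=
  [/\ D (t, x), tau 0 = 0,
      {within normal_ball X x r, continuous tau} &
      forall y, normal_ball X x r y ->
        D (tau y + t, x + enorm (X x) *: y) /\
        dot (phi (tau y + t) (x + enorm (X x) *: y) - phi t x)
            (X (phi t x)) = 0].

(* rescaled_poincare X D phi t x y w  means  P^*_{t,x}(y) = w.  The map is
   only locally defined, hence a relation; the ball on which the time
   correction lives is any ball of the normal space containing y. *)
Definition rescaled_poincare X D phi (t : R) (x y w : V) : Prop :=
  exists r (tau : V -> R),
    [/\ normal_ball X x r y, time_correction X D phi t x r tau &
        w = (enorm (X (phi t x)))^-1 *:
              (phi (tau y + t) (x + enorm (X x) *: y) - phi t x)].

(* extended_poincare X D phi t u y v  means  P^*(t,u,0,y) = v: as s -> 0+,
   u' -> u and y' -> y with u' unit and y' normal to X(su'), the values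
   P^*_{t,su'}(y') are eventually defined and converge to v. *)
Definition extended_poincare X D phi (t : R) (u y v : V) : Prop :=
  forall e : R, 0 < e -> exists2 del : R, 0 < del &
    forall (s : R) (u' y' : V),
      0 < s < del -> enorm u' = 1 -> enorm (u' - u) < del ->
      dot y' (X (s *: u')) = 0 -> enorm (y' - y) < del ->
      (exists w, rescaled_poincare X D phi t (s *: u') y' w) /\
      (forall w, rescaled_poincare X D phi t (s *: u') y' w ->
         enorm (w - v) < e).

End VectorFields.

(* Main.v *)
Require Import Defs.
From HB Require Import structures.
From mathcomp Require Import all_boot all_order all_algebra.
From mathcomp Require Import complex ring lra.
From mathcomp Require Import all_classical all_reals all_analysis.

Set Implicit Arguments.
Unset Strict Implicit.
Unset Printing Implicit Defensive.

Import Order.TTheory GRing.Theory Num.Theory.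
Import numFieldNormedType.Exports.

Local Open Scope classical_set_scope.
Local Open Scope ring_scope.

(* For small s > 0 conjugate X by the homothety of ratio s: X_s(p) = X(s p) / s.
   The rescaled Poincare map of X at s u is that of X_s at u, and X_s - A is
   arbitrarily Lipschitz-small on arbitrarily large balls as s -> 0, because f is
   C^1 with Df(0) = 0. By Gronwall the flow of X_s converges to that of A,
   uniformly on compact sets. The time correction is the zero of
   tau |-> <phi_(tau + t)(u + |X_s(u)| y) - phi_t(u), X_s(phi_t(u))>, whose
   derivative is bounded below by a positive constant near tau = 0; hence it is
   unique and stable under perturbation, and the maps converge to that of A,
   which is the same limit for every f (in particular for f = 0). *)

(** * Dot product, sup norm and derivatives *)

(** The limit is computed from the linear flow before any [f] is chosen, and [Y] is treated as one
    more perturbation of itself, so one value serves both fields. Three obstacles shape the proof.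
    The flow of [X] may be incomplete; near 0 the constant solution, maximality and openness of the
    domain keep it defined on any given time interval. The relation [rescaled_poincare] admits every
    continuous time correction, on any ball and with no smallness bound, so uniqueness of the small
    zero has to be carried along the segment from 0 to [y]. The sup norm is not differentiable, so
    Gronwall runs on [dot x x] and pays factors of [d]. The splitting of the space enters through
    the invertibility of [A], which keeps the field from vanishing at the end of the orbit. *)

Section DotProduct.
Context {R : realType} {d : nat}.
Local Notation V := 'cV[R]_d.
Implicit Types (x y z : V) (a : R).

Lemma dotE x y : dot x y = \sum_i x i 0 * y i 0.
Proof. by rewrite /dot mxE; apply: eq_bigr => i _; rewrite mxE. Qed.

Lemma dotC x y : dot x y = dot y x.
Proof. by rewrite !dotE; apply: eq_bigr => i _; rewrite mulrC. Qed.

Lemma dotDl x y z : dot (x + y) z = dot x z + dot y z.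
Proof.
by rewrite !dotE -big_split; apply: eq_bigr => i _ /=; rewrite mxE mulrDl.
Qed.

Lemma dotZl a x y : dot (a *: x) y = a * dot x y.
Proof.
by rewrite !dotE mulr_sumr; apply: eq_bigr => i _; rewrite mxE mulrA.
Qed.

Lemma dotBl x y z : dot (x - y) z = dot x z - dot y z.
Proof. by rewrite dotDl -scaleN1r dotZl mulN1r. Qed.

Lemma dotZr a x y : dot x (a *: y) = a * dot x y.
Proof. by rewrite dotC dotZl dotC. Qed.

Lemma dot0l x : dot 0 x = 0.
Proof. by rewrite -(scale0r 0) dotZl mul0r. Qed.

Lemma dot_ge0 x : 0 <= dot x x.
Proof. by rewrite dotE sumr_ge0// => i _; rewrite -expr2 sqr_ge0. Qed.

Lemma coord_le_norm m n (M : 'M[R]_(m, n)) i j : `|M i j| <= `|M|.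
Proof.
rewrite [leRHS]/Num.Def.normr/= mx_normrE.
exact: (le_bigmax _ (fun ij => `|M ij.1 ij.2|) (i, j)).
Qed.

Lemma norm_le_coord m n (M : 'M[R]_(m, n)) a : 0 <= a ->
  (forall i j, `|M i j| <= a) -> `|M| <= a.
Proof.
move=> a0 Ma; rewrite [leLHS]/Num.Def.normr/= mx_normrE.
by apply: bigmax_le => // -[i j] _; exact: Ma.
Qed.

(** With [norm_sqr_le_dot], compares the sup norm with the Euclidean one; this is the source of the
    factors [d] in the Gronwall constants. *)
Lemma dot_le x y : `|dot x y| <= d%:R * (`|x| * `|y|).
Proof.
rewrite dotE (le_trans (ler_norm_sum _ _ _))//.
rewrite (le_trans (ler_sum _ (G := fun=> `|x| * `|y|) _))//.
  by move=> i _; rewrite normrM ler_pM// coord_le_norm.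
by rewrite sumr_const card_ord mulr_natl.
Qed.

Lemma norm_sqr_le_dot x : `|x| ^+ 2 <= dot x x.
Proof.
have xi i : `|x i 0| ^+ 2 <= dot x x.
  rewrite real_normK ?num_real// dotE (bigD1 i)//= expr2 lerDl sumr_ge0// => j _.
  by rewrite -expr2 sqr_ge0.
rewrite -[leRHS]sqr_sqrtr ?dot_ge0// ler_sqr ?nnegrE ?sqrtr_ge0//.
apply: norm_le_coord => [|i j]; first exact: sqrtr_ge0.
by rewrite ord1 -[leLHS]ger0_norm// -sqrtr_sqr ler_wsqrtr.
Qed.

Lemma dot_gt0 x : x != 0 -> 0 < dot x x.
Proof.
move=> x0; apply: lt_le_trans (norm_sqr_le_dot x).
by rewrite exprn_gt0// normr_gt0.
Qed.

Lemma norm_le_enorm x : `|x| <= enorm x.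
Proof.
rewrite -[leLHS]ger0_norm// -sqrtr_sqr ler_wsqrtr//.
exact: norm_sqr_le_dot.
Qed.

Lemma enormZ a x : 0 <= a -> enorm (a *: x) = a * enorm x.
Proof.
move=> a0; rewrite /enorm dotZl dotZr mulrA -expr2 sqrtrM ?sqr_ge0//.
by rewrite sqrtr_sqr ger0_norm.
Qed.

Lemma enorm0 : enorm (0 : V) = 0.
Proof. by rewrite /enorm dot0l sqrtr0. Qed.

Lemma enorm_gt0 x : x != 0 -> 0 < enorm x.
Proof. by move=> x0; rewrite sqrtr_gt0 dot_gt0. Qed.

Lemma cvg_dot (T : Type) (F : set_system T) (FF : Filter F) (f g : T -> V) x y :
  f @ F --> x -> g @ F --> y -> dot (f t) (g t) @[t --> F] --> dot x y.
Proof.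
move=> fx gy; rewrite dotE; under eq_fun do rewrite dotE.
apply: (@cvg_big _ _ _ _ _ _ _ _ _ (fun i t => f t i 0 * g t i 0)) => [|i _].
  exact: add_continuous.
by apply: cvgM; [exact: (cvg_comp _ _ fx (@coord_continuous _ _ _ i 0 x))
  |exact: (cvg_comp _ _ gy (@coord_continuous _ _ _ i 0 y))].
Qed.

Lemma cvg_enorm (T : Type) (F : set_system T) (FF : Filter F) (f : T -> V) x :
  f @ F --> x -> enorm (f t) @[t --> F] --> enorm x.
Proof.
move=> fx; exact: (cvg_comp _ _ (cvg_dot FF fx fx) (@sqrt_continuous _ _)).
Qed.

End DotProduct.

Section Calculus.
Context {R : realType}.

Lemma is_derive_mxP (V : normedModType R) m n (M : V -> 'M[R]_(m, n))
    (t v : V) (D : 'M[R]_(m, n)) :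
  is_derive t v M D <-> forall i j, is_derive t v (fun x => M x i j) (D i j).
Proof.
split=> [MD i j|MD].
  have dM : derivable M t v by [].
  have := (derivable_mxP M t v).1 dM i j => dMij.
  by apply: DeriveDef => //; rewrite -(@derive_val _ _ _ _ _ _ _ MD) derive_mx// mxE.
have dM : derivable M t v by apply/derivable_mxP => i j; case: (MD i j).
apply: DeriveDef => //; apply/matrixP => i j; rewrite derive_mx// mxE.
exact: derive_val.
Qed.

Lemma is_derive_dot d (f g : R -> 'cV[R]_d) (t : R) (df dg : 'cV[R]_d) :
  is_derive t 1 f df -> is_derive t 1 g dg ->
  is_derive t 1 (fun s => dot (f s) (g s)) (dot df (g t) + dot (f t) dg).
Proof.
move=> /is_derive_mxP fd /is_derive_mxP gd.
have -> : (fun s => dot (f s) (g s)) =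
    \sum_(i < d) ((fun s => f s i 0) * (fun s => g s i 0)).
  by apply/funext => s; rewrite dotE fct_sumE.
apply: is_derive_eq.
rewrite !dotE -big_split; apply: eq_bigr => i _ /=.
by rewrite addrC /GRing.scale /= [g t i 0 * _]mulrC.
Qed.

(** Used with [a = 1] to restart an orbit at time [b] and with [a = -1] to reverse time. *)
Lemma is_derive_comp_affine m n (f : R -> 'M[R]_(m, n)) (df : 'M[R]_(m, n))
    (a b t : R) :
  is_derive (a * t + b) 1 f df ->
  is_derive t 1 (fun s => f (a * s + b)) (a *: df).
Proof.
move=> /is_derive_mxP fd; apply/is_derive_mxP => i j.
rewrite mxE mulrC.
have fij := fd i j.
have ab : is_derive t 1 (fun s => a * s + b) a.
  by apply: is_derive_eq; rewrite addr0 [_%:A]mulr1.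
exact: (@is_derive1_comp _ (fun s => f s i j) (fun s => a * s + b)).
Qed.

Lemma is_derive_continuous (V : normedModType R) (f : R -> V) (t : R) (df : V) :
  is_derive t 1 f df -> {for t, continuous f}.
Proof.
by move=> fd; apply/differentiable_continuous/derivable1_diffP.
Qed.

Lemma mulmx_bounded m n p (A : 'M[R]_(m, n)) :
  exists2 a : R, 0 <= a & forall x : 'M[R]_(n, p), `|A *m x| <= a * `|x|.
Proof.
exists (n%:R * `|A|) => [|x]; first by rewrite mulr_ge0.
apply: norm_le_coord => [|i j]; first by rewrite !mulr_ge0.
rewrite mxE (le_trans (ler_norm_sum _ _ _))//.
rewrite (le_trans (ler_sum _ (G := fun=> `|A| * `|x|) _))//.
  by move=> k _; rewrite normrM ler_pM// coord_le_norm.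
by rewrite sumr_const card_ord mulr_natl mulrnAl.
Qed.

End Calculus.

(** * Gronwall estimates *)

Section Gronwall.
Context {R : realType}.

(** The integrating factor turns the inequality into monotonicity of [h]. Asking for it only at
    interior times allows use up to a first exit time, where it may fail. *)
Lemma gronwall_interior (N N' : R -> R) (T a b : R) : 0 <= T -> 0 <= a -> 0 <= b ->
  (forall t : R, 0 <= t <= T -> is_derive t 1 N (N' t)) ->
  (forall t : R, 0 < t < T -> N' t <= a * N t + b) ->
  N T <= (N 0 + b * T) * expR (a * T).
Proof.
move=> T0 a0 b0 dN NN.
pose h t := N t * expR (- a * t) - b * t.
pose h' t := (N' t - a * N t) * expR (- a * t) - b.
have dh (t : R) : 0 <= t <= T -> is_derive t 1 h (h' t).
  move=> /dN dNt.
  have dmul (k : R) : is_derive t 1 ( *%R k) k.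
    by apply: is_derive_eq; rewrite /GRing.scale/= mulr1.
  have dexp : is_derive t 1 (fun s => expR (- a * s)) (expR (- a * t) * - a).
    exact: (@is_derive1_comp _ expR ( *%R (- a))).
  apply: is_derive_eq.
  by rewrite /h' /GRing.scale/=; ring.
have h_le : h T <= h 0.
  move: T0; rewrite le_eqVlt => /predU1P[<-//|T0].
  have [||c cT hT] := @MVT R h h' 0 T T0.
  - by move=> x; rewrite in_itv/= => /andP[x0 xT]; apply: dh; rewrite !ltW.
  - by apply: derivable_within_continuous => x; rewrite in_itv/= => /dh[].
  rewrite -subr_le0 hT subr0 pmulr_lle0// /h' subr_le0.
  move: cT; rewrite in_itv/= => cT; have /andP[c0 _] := cT.
  have e1 : expR (- a * c) <= 1.
    by rewrite -[leRHS]expR0 ler_expR mulNr oppr_le0 mulr_ge0// ltW.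
  apply: (@le_trans _ _ (b * expR (- a * c))); last by rewrite ler_piMr.
  by rewrite ler_wpM2r ?expR_ge0// lerBlDl NN.
move: h_le; rewrite /h !mulr0 expR0 mulr1 subr0 lerBlDr => h_le.
have := ler_wpM2r (expR_ge0 (a * T)) h_le.
by rewrite -mulrA -expRD mulNr addNr expR0 mulr1.
Qed.

(* The differential inequality is only needed below the level [B], which the
   resulting bound keeps [N] from ever reaching. *)
Lemma gronwall (N N' : R -> R) (T a b B : R) : 0 <= a -> 0 <= b -> 0 <= N 0 ->
  (forall t : R, 0 <= t <= T -> is_derive t 1 N (N' t)) ->
  (forall t : R, 0 <= t <= T -> N t < B -> N' t <= a * N t + b) ->
  (N 0 + b * T) * expR (a * T) < B ->
  forall t : R, 0 <= t <= T -> N t <= (N 0 + b * T) * expR (a * T).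
Proof.
move=> a0 b0 N0 dN NN KB.
have mono (t : R) : 0 <= t <= T ->
    (N 0 + b * t) * expR (a * t) <= (N 0 + b * T) * expR (a * T).
  move=> /andP[t0 tT]; rewrite ler_pM ?expR_ge0 ?addr_ge0 ?mulr_ge0//.
    by rewrite lerD2l ler_wpM2l.
  by rewrite ler_expR ler_wpM2l.
suff NB (t : R) : 0 <= t <= T -> N t < B.
  move=> t tT; apply: le_trans (mono _ tT); have /andP[t0 t_T] := tT.
  apply: (gronwall_interior (N' := N')) => // s sT.
    by apply: dN; lra.
  by apply: NN; [|apply: NB]; lra.
move=> tT; rewrite ltNge; apply/negP => Bt.
(* [inf S] is the first time at which [N] would reach [B]. Before it the inequality holds, so
   [N (inf S) < B]; by continuity [N] stays below [B] a little longer, against the points of [S]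
   close to [inf S]. *)
pose S := [set s : R | 0 <= s <= T /\ B <= N s].
have S0 : S !=set0 by exists t.
have hS : has_inf S by split=> //; exists 0 => s [/andP[? _] _].
have Sm s : S s -> inf S <= s by move=> ?; apply: ge_inf => //; case: hS.
have m0 : 0 <= inf S by apply: lb_le_inf => // s [/andP[? _] _].
have mT : inf S <= T.
  by apply: (le_trans (Sm t _)) => //; have /andP[] := tT.
have m0T : 0 <= inf S <= T by apply/andP.
have Nm : N (inf S) < B.
  apply: le_lt_trans KB; apply: le_trans (mono _ m0T).
  apply: (gronwall_interior (N' := N')) => // s sT; first by apply: dN; lra.
  apply: NN; first by lra.
  rewrite ltNge; apply/negP => Bs.
  by have := Sm s (conj _ Bs) => /(_ _); lra.
have /is_derive_continuous Nc : is_derive (inf S) 1 N (N' (inf S)).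
  by apply: dN; apply/andP.
have /nbhs_ballP[e /= e0 eN] : \forall s \near inf S, N s < B.
  exact: (cvgr_lt _ Nc).
have [s Ss sm] := inf_adherent e0 hS.
have : N s < B.
  by apply: eN; rewrite /ball/= ltr_distlC; have := Sm _ Ss; lra.
by rewrite ltNge (proj2 Ss).
Qed.

End Gronwall.

Section VectorGronwall.
Context {R : realType} {d : nat}.
Local Notation V := 'cV[R]_d.

(** Gronwall for [dot e e], whose derivative is twice [dot e e']. The bound [2 |e| b <= |e|^2 + b^2]
    produces the rate [d (2 a + 1)] and the source [d b^2]. Negative times follow by reversing
    time. *)
Lemma norm_growth (e e' : R -> V) (x0 : V) (T a b B : R) : e 0 = x0 -> 0 <= a -> 0 <= b -> 0 < B ->
  (forall t : R, `|t| <= T -> is_derive t 1 e (e' t)) ->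
  (forall t : R, `|t| <= T -> `|e t| < B -> `|e' t| <= a * `|e t| + b) ->
  d%:R * (`|x0| ^+ 2 + b ^+ 2 * T) * expR (d%:R * (2 * a + 1) * T) < B ^+ 2 ->
  forall t : R, `|t| <= T ->
  `|e t| ^+ 2 <= d%:R * (`|x0| ^+ 2 + b ^+ 2 * T) * expR (d%:R * (2 * a + 1) * T).
Proof.
move=> <- a0 b0 B0.
have half (f f' : R -> V) :
  (forall t : R, 0 <= t <= T -> is_derive t 1 f (f' t)) ->
  (forall t : R, 0 <= t <= T -> `|f t| < B -> `|f' t| <= a * `|f t| + b) ->
  d%:R * (`|f 0| ^+ 2 + b ^+ 2 * T) * expR (d%:R * (2 * a + 1) * T) < B ^+ 2 ->
  forall t : R, 0 <= t <= T ->
  `|f t| ^+ 2 <= d%:R * (`|f 0| ^+ 2 + b ^+ 2 * T) * expR (d%:R * (2 * a + 1) * T).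
  move=> df ff KB t tT.
  pose N s := dot (f s) (f s).
  have N0 : N 0 <= d%:R * `|f 0| ^+ 2.
    by rewrite (le_trans (ler_norm _))// expr2 dot_le.
  have KK : (N 0 + d%:R * b ^+ 2 * T) * expR (d%:R * (2 * a + 1) * T) <=
      d%:R * (`|f 0| ^+ 2 + b ^+ 2 * T) * expR (d%:R * (2 * a + 1) * T).
    by rewrite ler_wpM2r ?expR_ge0// mulrDr [d%:R * (_ * T)]mulrA lerD2r.
  apply: le_trans (norm_sqr_le_dot _) _; apply: (le_trans _ KK).
  apply: (@gronwall _ N (fun s => dot (f' s) (f s) + dot (f s) (f' s)) T _ _
    (B ^+ 2)) => //.
  - by rewrite mulr_ge0//; lra.
  - by rewrite mulr_ge0// sqr_ge0.
  - exact: dot_ge0.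
  - by move=> s /df dfs; apply: is_derive_dot.
  - move=> s sT NB; rewrite [dot (f' s) _]dotC.
    have fB : `|f s| < B.
      have := le_lt_trans (norm_sqr_le_dot (f s)) NB.
      by rewrite ltr_sqr ?nnegrE// (ltW B0).
    have := dot_le (f s) (f' s); have := ff s sT fB; have := norm_sqr_le_dot (f s).
    rewrite -/(N s) => fN f'le dle.
    have d0 : 0 <= d%:R :> R by [].
    have f0 := normr_ge0 (f s).
    have h1 : `|f s| * `|f' s| <= `|f s| * (a * `|f s| + b) by rewrite ler_wpM2l.
    have h2 : 2 * (`|f s| * (a * `|f s| + b)) <= (2 * a + 1) * N s + b ^+ 2.
      have := sqr_ge0 (`|f s| - b).
      have : (2 * a + 1) * `|f s| ^+ 2 <= (2 * a + 1) * N s by rewrite ler_wpM2l//; lra.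
      lra.
    have h3 : dot (f s) (f' s) <= d%:R * (`|f s| * `|f' s|) := le_trans (ler_norm _) dle.
    have := ler_wpM2l d0 h2; have := ler_wpM2l d0 h1; lra.
  - exact: le_lt_trans KK KB.
move=> de ee KB t tT.
have [t0|t0] := leP 0 t.
  apply: half => // [s|s|]; last by rewrite t0 -(ger0_norm t0).
  - by move=> ?; apply: de; rewrite ger0_norm; lra.
  - by move=> ?; apply: ee; rewrite ger0_norm; lra.
have /= := @half (fun s => e (- 1 * s + 0)) (fun s => -1 *: e' (- 1 * s + 0)).
rewrite mulr0 addr0 => /(_ _ _ KB (- t)).
rewrite mulN1r opprK addr0; apply.
- move=> s sT; apply: is_derive_comp_affine; apply: de.
  by rewrite mulN1r addr0 normrN ger0_norm; lra.
- move=> s sT; rewrite scaleN1r normrN; apply: ee.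
  by rewrite mulN1r addr0 normrN ger0_norm; lra.
- by rewrite ltr0_norm// in tT; lra.
Qed.

End VectorGronwall.

(** * Flows of almost linear vector fields *)

(** Field, domain and flow form a single point, so that convergence of fields is a filter on such
    points and combines with the limits in [u'] and [y'] as a product filter. *)
Record flow_data (R : realType) (d : nat) := FlowData {
  vfield : 'cV[R]_d -> 'cV[R]_d ;
  flowdom : set (R * 'cV[R]_d) ;
  flow : R -> 'cV[R]_d -> 'cV[R]_d
}.

(** One parameter bounds the Lipschitz constant of the remainder and, through [del^-1], the radius
    and the time span under control. The condition strengthens as [del] decreases, so these sets
    form a filter base. *)
Record almost_linear (R : realType) (d : nat) (A : 'M[R]_d) (del : R)
    (p : flow_data R d) : Prop := AlmostLinear {
  al_field0 : vfield p 0 = 0 ;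
  al_lipschitz : forall x y, `|x| <= del^-1 -> `|y| <= del^-1 ->
    `|(vfield p x - A *m x) - (vfield p y - A *m y)| <= del * `|x - y| ;
  al_start : forall x, flow p 0 x = x ;
  al_derive : forall t x, flowdom p (t, x) ->
    is_derive t 1 (flow p ^~ x) (vfield p (flow p t x)) ;
  al_dom : forall t x, `|t| <= del^-1 -> `|x| <= del^-1 -> flowdom p (t, x)
}.

Definition to_linear (R : realType) (d : nat) (A : 'M[R]_d) :
    set_system (flow_data R d) :=
  filter_from [set del : R | 0 < del] (fun del => [set p | almost_linear A del p]).

Section AlmostLinear.
Context {R : realType} {d : nat} (A : 'M[R]_d).
Local Notation V := 'cV[R]_d.
Implicit Types (p : flow_data R d) (x y : V) (del : R).

Lemma almost_linear_le del1 del2 p : 0 < del1 -> del1 <= del2 ->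
  almost_linear A del1 p -> almost_linear A del2 p.
Proof.
move=> d1 d12 [p0 pl ps pd pD].
have d21 : del2^-1 <= del1^-1 by rewrite lef_pV2 ?posrE//; exact: lt_le_trans d12.
split=> // [x y xd yd|t x td xd]; last by apply: pD; exact: le_trans d21.
apply: le_trans (pl _ _ (le_trans xd d21) (le_trans yd d21)) _.
by rewrite ler_wpM2r.
Qed.

#[global] Instance to_linear_filter : Filter (to_linear A).
Proof.
apply: filter_from_filter; first by exists 1 => /=.
move=> i j /= i0 j0; exists (Num.min i j); first by rewrite /= lt_min i0.
move=> p /= pij; have m0 : 0 < Num.min i j by rewrite lt_min i0.
by split; apply: (almost_linear_le m0 _ pij); rewrite // ge_min lexx ?orbT.
Qed.

Lemma near_to_linear del : 0 < del ->
  \forall p \near to_linear A, almost_linear A del p.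
Proof. by move=> d0; exists del. Qed.

Lemma small_inverse (M1 M2 M3 e : R) : 0 < e -> exists2 del : R, 0 < del <= e &
  [/\ M1 <= del^-1, M2 <= del^-1 & M3 <= del^-1].
Proof.
move=> e0; pose S := `|M1| + `|M2| + `|M3| + e^-1.
have h1 := ler_norm M1; have h2 := ler_norm M2; have h3 := ler_norm M3.
have n1 := normr_ge0 M1; have n2 := normr_ge0 M2; have n3 := normr_ge0 M3.
have ei : 0 < e^-1 by rewrite invr_gt0.
have S0 : 0 < S by rewrite /S; lra.
exists S^-1; last by rewrite invrK /S; split; lra.
by rewrite invr_gt0 S0 -[leRHS]invrK lef_pV2 ?posrE// /S; lra.
Qed.

Section Bounds.
Variables (a : R) (Aa : forall x : V, `|A *m x| <= a * `|x|).
Hypothesis a0 : 0 <= a.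

Lemma field_lipschitz del p x y : almost_linear A del p -> del <= 1 ->
  `|x| <= del^-1 -> `|y| <= del^-1 ->
  `|vfield p x - vfield p y| <= (a + 1) * `|x - y|.
Proof.
move=> ap d1 xd yd; have := al_lipschitz ap xd yd.
set u := _ - _ - _ => ud.
have -> : vfield p x - vfield p y = u + A *m (x - y).
  by rewrite /u mulmxBr; move: (A *m x) (A *m y) => w z; apply/matrixP => i j; rewrite !mxE; ring.
rewrite (le_trans (ler_normD _ _))// addrC mulrDl lerD//.
by rewrite (le_trans ud)// ler_wpM2r.
Qed.

Lemma field_bound del p x : almost_linear A del p -> 0 < del <= 1 ->
  `|x| <= del^-1 -> `|vfield p x| <= (a + 1) * `|x|.
Proof.
move=> ap /andP[d0 d1] xd.
have := field_lipschitz (y := 0) ap d1 xd.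
by rewrite (al_field0 ap) !subr0 normr0 invr_ge0 ltW// => /(_ isT).
Qed.

(** The field is controlled only on the ball of radius [del^-1]. The bound is therefore computed
    from [a], [T] and [K], and [del] is taken afterwards with the bound below [del^-1]; the level in
    [norm_growth] breaks the circularity. *)
Lemma flow_bound (T K : R) : exists2 M : R, 0 < M &
  \forall p \near to_linear A, forall t x, `|t| <= T -> `|x| <= K ->
    `|flow p t x| <= M.
Proof.
pose E := expR (d%:R * (2 * (a + 1) + 1) * T).
have E0 : 0 <= E := expR_ge0 _.
have B20 : 0 < d%:R * K ^+ 2 * E + 1.
  by rewrite ltr_wpDl// mulr_ge0// mulr_ge0 ?sqr_ge0.
pose B := Num.sqrt (d%:R * K ^+ 2 * E + 1).
have B0 : 0 < B by rewrite sqrtr_gt0.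
have B2 : B ^+ 2 = d%:R * K ^+ 2 * E + 1 by rewrite sqr_sqrtr// ltW.
exists B => //.
have [del /andP[d0 d1] [dB dT dK]] := small_inverse B T K ltr01.
near=> p => t x tT xK.
have ap : almost_linear A del p by near: p; exact: near_to_linear.
have K2 : d%:R * (`|x| ^+ 2 + 0 ^+ 2 * T) * E < B ^+ 2.
  rewrite B2 expr0n/= mul0r addr0 ltr_pwDr// ler_wpM2r// ler_wpM2l//.
  by rewrite ler_sqr ?nnegrE// (le_trans _ xK).
rewrite -ler_sqr ?nnegrE ?(ltW B0)//; apply: le_trans (ltW K2).
apply: (@norm_growth R d (flow p ^~ x) (fun s => vfield p (flow p s x))
  _ _ _ _ B (al_start ap x)) => //.
- by rewrite addr_ge0.
- move=> s sT; apply: (al_derive ap); apply: (al_dom ap).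
    exact: (le_trans sT dT).
  exact: (le_trans _ dK).
- move=> s sT sB; rewrite addr0; apply: (field_bound ap); first exact/andP.
  by apply: le_trans dB; exact: ltW.
Unshelve. all: by end_near. Qed.

(** By [flow_bound] both orbits stay where the field is Lipschitz with constant [a + 1], so their
    difference obeys Gronwall with [b = 0], uniformly in [p]. *)
Lemma flow_lipschitz (T K : R) : exists2 C : R, 0 <= C &
  \forall p \near to_linear A, forall t x y, `|t| <= T -> `|x| <= K ->
    `|y| <= K -> `|flow p t x - flow p t y| <= C * `|x - y|.
Proof.
have [M M0 bM] := flow_bound T K.
pose E := expR (d%:R * (2 * (a + 1) + 1) * T).
have E0 : 0 <= E := expR_ge0 _.
exists (Num.sqrt (d%:R * E)) => //.
have [del /andP[d0 d1] [dM dT dK]] := small_inverse M T K ltr01.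
near=> p => t x y tT xK yK.
have ap : almost_linear A del p by near: p; exact: near_to_linear.
have bMp t1 x1 : `|t1| <= T -> `|x1| <= K -> `|flow p t1 x1| <= M.
  by move: t1 x1; near: p; exact: bM.
have dflow (s : R) (z : V) : `|s| <= T -> `|z| <= K ->
    is_derive s 1 (flow p ^~ z) (vfield p (flow p s z)).
  move=> sT zK; apply: (al_derive ap); apply: (al_dom ap).
    exact: (le_trans sT dT).
  exact: (le_trans _ dK).
pose S := d%:R * (`|x - y| ^+ 2 + 0 ^+ 2 * T) * E.
have S0 : 0 <= S.
  by rewrite /S expr0n/= mul0r addr0 mulr_ge0// mulr_ge0 ?sqr_ge0.
have SB : S < Num.sqrt (S + 1) ^+ 2 by rewrite sqr_sqrtr; lra.
have B0 : 0 < Num.sqrt (S + 1) by rewrite sqrtr_gt0; lra.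
rewrite -ler_sqr ?nnegrE ?mulr_ge0// exprMn sqr_sqrtr ?mulr_ge0//.
have -> : d%:R * E * `|x - y| ^+ 2 = S.
  by rewrite /S expr0n/= mul0r addr0 mulrAC.
apply: (@norm_growth R d (fun s => flow p s x - flow p s y)
  (fun s => vfield p (flow p s x) - vfield p (flow p s y)) _ _ _ _ _ _ _ _ B0) => //.
- by rewrite !(al_start ap).
- by rewrite addr_ge0.
- by move=> s sT; apply: is_deriveB; exact: dflow.
- move=> s sT _; rewrite addr0.
  by apply: (field_lipschitz ap d1); apply: le_trans (bMp _ _ sT _) dM.
Unshelve. all: by end_near. Qed.

Section LinearFlow.
Variable q : flow_data R d.
Hypothesis ql : forall del, 0 < del -> almost_linear A del q.
Hypothesis qA : forall x, vfield q x = A *m x.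

(** The difference [e] of two orbits from the same point satisfies [|e'| <= a |e| + del M], the
    source being the remainder at a point of norm at most [M]; Gronwall bounds [|e|^2] by
    [C del^2]. *)
Lemma flow_close (T K e : R) : 0 < e ->
  \forall p \near to_linear A, forall t x, `|t| <= T -> `|x| <= K ->
    `|flow p t x - flow q t x| <= e.
Proof.
move=> e0.
have [M M0 bM] := flow_bound T K.
(* For negative [T] no time qualifies; afterwards [0 <= T] makes [C] nonnegative. *)
have [T0|T0] := ltP T 0.
  near=> p => t x tT; suff : false by [].
  by have := le_lt_trans tT T0; rewrite normr_lt0.
pose E := expR (d%:R * (2 * a + 1) * T).
have E0 : 0 <= E := expR_ge0 _.
pose C := d%:R * (M ^+ 2 * T) * E.
have C0 : 0 <= C by rewrite /C mulr_ge0// mulr_ge0// mulr_ge0 ?sqr_ge0.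
have C1 : 0 < C + 1 by rewrite ltr_wpDl.
(* With [del <= e / (C + 1)], one gets [C del^2 <= (C + 1)^2 del^2 <= e^2]. *)
have [del /andP[d0 de] [dM dT dK]] := small_inverse M T K (divr_gt0 e0 C1).
near=> p => t x tT xK.
have ap : almost_linear A del p by near: p; exact: near_to_linear.
have bMp t1 x1 : `|t1| <= T -> `|x1| <= K -> `|flow p t1 x1| <= M.
  by move: t1 x1; near: p; exact: bM.
have dflow r (s : R) (z : V) : almost_linear A del r -> `|s| <= T -> `|z| <= K ->
    is_derive s 1 (flow r ^~ z) (vfield r (flow r s z)).
  move=> ar sT zK; apply: (al_derive ar); apply: (al_dom ar).
    exact: (le_trans sT dT).
  exact: (le_trans _ dK).
pose S := d%:R * (`|0 : V| ^+ 2 + (del * M) ^+ 2 * T) * E.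
have S0 : 0 <= S.
  by rewrite /S normr0 expr0n/= add0r mulr_ge0// mulr_ge0// mulr_ge0 ?sqr_ge0.
have SB : S < Num.sqrt (S + 1) ^+ 2 by rewrite sqr_sqrtr; lra.
have B0 : 0 < Num.sqrt (S + 1) by rewrite sqrtr_gt0; lra.
have Se : S <= e ^+ 2.
  have -> : S = C * del ^+ 2 by rewrite /S /C normr0; ring.
  rewrite (@le_trans _ _ ((del * (C + 1)) ^+ 2))//.
    rewrite exprMn mulrC ler_wpM2l ?sqr_ge0//.
    by have := sqr_ge0 C; lra.
  by rewrite ler_sqr ?nnegrE ?mulr_ge0 ?(ltW d0) ?(ltW e0) ?(ltW C1)// -ler_pdivlMr.
rewrite -ler_sqr ?nnegrE ?(ltW e0)//; apply: le_trans Se.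
apply: (@norm_growth R d (fun s => flow p s x - flow q s x)
  (fun s => vfield p (flow p s x) - vfield q (flow q s x)) _ _ _ _ _ _ _ _ B0) => //.
- by rewrite (al_start ap) (al_start (ql d0)) subrr.
- by rewrite mulr_ge0// ltW.
- by move=> s sT; apply: is_deriveB; apply: dflow => //; exact: ql.
- move=> s sT _; rewrite qA.
  set y := flow p s x; set z := flow q s x.
  have -> : vfield p y - A *m z = A *m (y - z) + (vfield p y - A *m y).
    rewrite mulmxBr; move: (A *m y) (A *m z) => w1 w2.
    by apply/matrixP => i j; rewrite !mxE; ring.
  rewrite (le_trans (ler_normD _ _))// lerD//.
  have yM : `|y| <= M by exact: bMp.
  have := al_lipschitz (y := 0) ap (le_trans yM dM).
  rewrite normr0 invr_ge0 (ltW d0) (al_field0 ap) mulmx0 !subr0 => /(_ isT) h'.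
  by rewrite (le_trans h')// ler_wpM2l// ltW.
Unshelve. all: by end_near. Qed.

End LinearFlow.
End Bounds.
End AlmostLinear.

(** * Stability of the time correction *)

Section Filters.
Context {R : realType}.

(** Yields a radius that does not depend on the index; this is how the time interval and the radius
    in [y] become uniform over the perturbed fields. *)
Lemma filter_prod_ball (T : Type) (F : set_system T) (FF : Filter F)
    (V : normedModType R) (x0 : V) (P : T -> V -> Prop) :
  (\forall z \near filter_prod F (nbhs x0), P z.1 z.2) ->
  exists2 e : R, 0 < e & \forall i \near F, forall x, `|x - x0| < e -> P i x.
Proof.
move=> [[Q S] /= [FQ /nbhs_normP[e /= e0 eS]] QS]; exists e => //.
apply: filterS FQ => i Qi x xe; apply: (QS (i, x)); split => //.
by apply: eS; rewrite /= distrC.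
Qed.

End Filters.

Section StronglyIncreasing.
Context {R : realType}.
Variables (g g' : R -> R) (c T : R).
Hypothesis dg : forall t : R, `|t| <= T -> is_derive t 1 g (g' t).
Hypothesis cg' : forall t : R, `|t| <= T -> c <= g' t.

Let itv_norm (a b x : R) : `|a| <= T -> `|b| <= T -> a <= x <= b -> `|x| <= T.
Proof. by rewrite !ler_norml; lra. Qed.

Let cont (a b : R) : `|a| <= T -> `|b| <= T -> {within `[a, b], continuous g}.
Proof.
move=> aT bT; apply: derivable_within_continuous => x; rewrite in_itv/= => xab.
by have [] := dg (itv_norm aT bT xab).
Qed.

Lemma increase_ge (s t : R) : `|s| <= T -> `|t| <= T -> s <= t ->
  c * (t - s) <= g t - g s.
Proof.
move=> sT tT st.
have [||x] := @MVT_segment R g g' s t st.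
- by move=> x; rewrite in_itv/= => xst; apply/dg/(itv_norm sT tT); lra.
- exact: cont.
rewrite in_itv/= => /(itv_norm sT tT) xT ->.
by rewrite ler_wpM2r ?subr_ge0// cg'.
Qed.

Lemma dist_le_increase (s t : R) : `|s| <= T -> `|t| <= T ->
  c * `|t - s| <= `|g t - g s|.
Proof.
move=> sT tT; have [st|/ltW ts] := leP s t.
  by rewrite ger0_norm ?subr_ge0// (le_trans (increase_ge sT tT st))// ler_norm.
by rewrite distrC ger0_norm ?subr_ge0// distrC
  (le_trans (increase_ge tT sT ts))// ler_norm.
Qed.

(** On each side of 0, over a length [T / 2], the function moves by at least [c T / 2], hence by at
    least [|g 0|], and the intermediate value theorem applies. That the zero stays in the inner half
    is what later confines continuous corrections. *)
Lemma zero_exists : 0 < T -> 2 * `|g 0| <= c * T ->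
  exists2 z : R, 2 * `|z| <= T & g z = 0.
Proof.
move=> T0 g0.
have T0' : `|0 : R| <= T by rewrite normr0 ltW.
have hT : `|T / 2| <= T by rewrite ger0_norm; lra.
have hT' : `|- (T / 2)| <= T by rewrite normrN.
have TT : - (T / 2) <= T / 2 by lra.
have up := increase_ge T0' hT (_ : 0 <= T / 2).
have lo := increase_ge hT' T0' (_ : - (T / 2) <= 0).
have gn : - `|g 0| <= g 0 <= `|g 0| by rewrite -ler_norml.
have glo : g (- (T / 2)) <= 0 by have := lo ltac:(lra); lra.
have gup : 0 <= g (T / 2) by have := up ltac:(lra); lra.
have [|z] := IVT (v := 0) TT (cont hT' hT).
  by rewrite ge_min glo/= le_max gup orbT.
rewrite in_itv/= => zT gz; exists z => //.
suff : `|z| <= T / 2 by lra.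
by rewrite ler_norml.
Qed.

End StronglyIncreasing.

Section ImplicitTime.
Context {R : realType} {d : nat} (A : 'M[R]_d).
Local Notation V := 'cV[R]_d.
Variable q : flow_data R d.
Hypothesis ql : forall del, 0 < del -> almost_linear A del q.
Hypothesis qA : forall x, vfield q x = A *m x.

(** [q] lies in every set of the filter, so a bound proved near the linear flow holds for it. *)
Lemma near_to_linear_self (P : flow_data R d -> Prop) :
  (\forall p \near to_linear A, P p) -> P q.
Proof. by move=> [del /= d0]; apply; exact: ql. Qed.

Section Convergence.
Context (I : Type) (F : set_system I) (FF : Filter F).
Variables (p : I -> flow_data R d).
Hypothesis cp : p @ F --> to_linear A.

Lemma near_along (P : flow_data R d -> Prop) :
  (\forall p \near to_linear A, P p) -> \forall i \near F, P (p i).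
Proof. by move=> ?; exact: cp. Qed.

Lemma field_cvg (x : I -> V) x0 : x @ F --> x0 ->
  vfield (p i) (x i) @[i --> F] --> A *m x0.
Proof.
move=> cx; have [a a0 Aa] := mulmx_bounded 1 A.
have a1 : 0 < a + 1 by rewrite ltr_wpDl.
have xn : `|x0| + 1 > 0 by rewrite ltr_wpDl.
apply/cvgrPdist_le => e e0.
(* The remainder at [x i] is at most [del (|x0| + 1)], which this choice makes at most [e / 2]. *)
have [del /andP[d0 de] [dx _ _]] :=
  small_inverse (`|x0| + 1) 0 0 (divr_gt0 e0 (mulr_gt0 (ltr0n R 2) xn)).
near=> i.
have al : almost_linear A del (p i).
  by near: i; apply: near_along; exact: near_to_linear.
have x1 : `|x0 - x i| <= 1.
  by near: i; move/cvgrPdist_le : cx; apply.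
have xe : `|x0 - x i| <= e / 2 / (a + 1).
  by near: i; move/cvgrPdist_le : cx; apply; rewrite !divr_gt0.
have xi : `|x i| <= `|x0| + 1.
  have -> : x i = x0 - (x0 - x i) by rewrite opprB addrC subrK.
  by rewrite (le_trans (ler_normB _ _))// lerD2l.
have := al_lipschitz (y := 0) al (le_trans xi dx).
rewrite normr0 invr_ge0 (ltW d0) (al_field0 al) mulmx0 !subr0 => /(_ isT) h.
have -> : A *m x0 - vfield (p i) (x i) =
    A *m (x0 - x i) - (vfield (p i) (x i) - A *m x i).
  rewrite mulmxBr; move: (A *m x0) (A *m x i) => w1 w2.
  by apply/matrixP => k j; rewrite !mxE; ring.
rewrite (le_trans (ler_normB _ _))// [leRHS]splitr lerD//.
  rewrite (le_trans (Aa _))//; move: xe; rewrite ler_pdivlMr// => xe.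
  rewrite (le_trans _ xe)// mulrC ler_wpM2l//; lra.
rewrite (le_trans h)//; move: de; rewrite ler_pdivlMr ?mulr_gt0// => de.
have := ler_wpM2l (ltW d0) xi; lra.
Unshelve. all: by end_near. Qed.

(** Three errors are added: the change of time along the orbit of [x0] under [q], the change of
    initial point under [q], and the change of field, which is uniform on bounded sets. *)
Lemma flow_cvg (t : I -> R) (x : I -> V) t0 x0 : t @ F --> t0 -> x @ F --> x0 ->
  flow (p i) (t i) (x i) @[i --> F] --> flow q t0 x0.
Proof.
move=> ct cx; have [a a0 Aa] := mulmx_bounded 1 A.
have [C C0 Clip] := flow_lipschitz Aa a0 (`|t0| + 1) (`|x0| + 1).
have {}Clip := near_to_linear_self Clip.
have C1 : 0 < C + 1 by rewrite ltr_wpDl.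
have qc : flow q (t i) x0 @[i --> F] --> flow q t0 x0.
  apply: (cvg_comp _ (flow q ^~ x0) ct).
  have qD : flowdom q (t0, x0).
    have [del /andP[d0 _] [dt dx _]] := small_inverse `|t0| `|x0| 0 (@ltr01 R).
    exact: (al_dom (ql d0)).
  exact: (is_derive_continuous (al_derive (ql ltr01) qD)).
apply/cvgrPdist_le => e e0.
have e3 : 0 < e / 3 by rewrite divr_gt0.
have pq := flow_close Aa a0 ql qA (`|t0| + 1) (`|x0| + 1) e3.
near=> i.
have x1 : `|x0 - x i| <= 1.
  by near: i; move/cvgrPdist_le : cx; apply.
have t1 : `|t0 - t i| <= 1.
  by near: i; move/cvgrPdist_le : ct; apply.
have xe : `|x0 - x i| <= e / 3 / (C + 1).
  by near: i; move/cvgrPdist_le : cx; apply; rewrite divr_gt0.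
have qe : `|flow q t0 x0 - flow q (t i) x0| <= e / 3.
  by near: i; move/cvgrPdist_le : qc; apply.
have xi : `|x i| <= `|x0| + 1.
  have -> : x i = x0 - (x0 - x i) by rewrite opprB addrC subrK.
  by rewrite (le_trans (ler_normB _ _))// lerD2l.
have ti : `|t i| <= `|t0| + 1.
  have -> : t i = t0 - (t0 - t i) by rewrite opprB addrC subrK.
  by rewrite (le_trans (ler_normB _ _))// lerD2l.
have pe : `|flow (p i) (t i) (x i) - flow q (t i) (x i)| <= e / 3.
  by move: xi ti; near: i; apply: filterS (near_along pq) => j pj xj tj; exact: pj.
have qx : `|flow q (t i) x0 - flow q (t i) (x i)| <= e / 3.
  rewrite (le_trans (Clip _ _ _ ti _ xi))// ?lerDl//.
  move: xe; rewrite ler_pdivlMr// => xe.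
  by rewrite (le_trans _ xe)// mulrC ler_wpM2l// lerDl.
have -> : flow q t0 x0 - flow (p i) (t i) (x i) =
    (flow q t0 x0 - flow q (t i) x0) + (flow q (t i) x0 - flow q (t i) (x i))
    - (flow (p i) (t i) (x i) - flow q (t i) (x i)).
  by apply/matrixP => k j; rewrite !mxE; ring.
have h1 := ler_normB ((flow q t0 x0 - flow q (t i) x0) +
  (flow q (t i) x0 - flow q (t i) (x i)))
  (flow (p i) (t i) (x i) - flow q (t i) (x i)).
have h2 := ler_normD (flow q t0 x0 - flow q (t i) x0)
  (flow q (t i) x0 - flow q (t i) (x i)).
apply: (le_trans h1); apply: (le_trans (lerD (le_trans h2 (lerD qe qx)) pe)); lra.
Unshelve. all: by end_near. Qed.

End Convergence.
End ImplicitTime.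

(** * Existence, uniqueness and continuity of the time correction for one field *)

Section TimeCorrection.
Context {R : realType} {d : nat}.
Local Notation V := 'cV[R]_d.
Variable t : R.
Implicit Types (p : flow_data R d) (u y w : V).

Definition launch p u y := u + enorm (vfield p u) *: y.

Definition disp p u y tau := flow p (tau + t) (launch p u y) - flow p t u.

Definition gap p u y tau := dot (disp p u y tau) (vfield p (flow p t u)).

Definition gap_rate p u y tau :=
  dot (vfield p (flow p (tau + t) (launch p u y))) (vfield p (flow p t u)).

Definition poincare_value p u y tau :=
  (enorm (vfield p (flow p t u)))^-1 *: disp p u y tau.

(* The zero of [gap p u y] in [[-T, T]] is the time correction; these bounds
   make it exist, be unique and depend continuously on [y]. *)
Record transversal (c T r : R) p u : Prop := Transversal {
  tr_base : flowdom p (t, u) ;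
  tr_dom : forall y tau, `|y| < r -> `|tau| <= T ->
    flowdom p (tau + t, launch p u y) ;
  tr_rate : forall y tau, `|y| < r -> `|tau| <= T -> c <= gap_rate p u y tau ;
  tr_gap0 : forall y, `|y| < r -> 2 * `|gap p u y 0| <= c * T ;
  tr_lip : exists2 C : R, 0 <= C & forall y1 y2 tau, `|y1| < r -> `|y2| < r ->
    `|tau| <= T -> `|gap p u y1 tau - gap p u y2 tau| <= C * `|y1 - y2|
}.

Section Fixed.
Context (A : 'M[R]_d) (c T r del : R) (p : flow_data R d) (u : V).
Hypothesis al : almost_linear A del p.
Hypotheses (c0 : 0 < c) (T0 : 0 < T) (r0 : 0 < r).
Hypothesis tr : transversal c T r p u.

Lemma gap_derive y (tau : R) : `|y| < r -> `|tau| <= T ->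
  is_derive tau 1 (gap p u y) (gap_rate p u y tau).
Proof.
move=> yr tauT; pose x := launch p u y.
have dx : is_derive tau 1 (fun s => flow p (s + t) x) (vfield p (flow p (tau + t) x)).
  have := al_derive al (tr_dom tr yr tauT).
  rewrite -{1}[tau]mul1r => /is_derive_comp_affine; rewrite scale1r.
  by under [fun s => flow p (1 * s + t) _]eq_fun do rewrite mul1r.
have dd : is_derive tau 1 (disp p u y) (vfield p (flow p (tau + t) x)).
  by apply: is_derive_eq; rewrite subr0.
have := is_derive_dot dd (is_derive_cst (vfield p (flow p t u)) tau 1).
by rewrite [dot _ 0]dotC dot0l addr0.
Qed.

(** Injectivity in time with a modulus: it gives uniqueness of the zero, its continuity in [y], and
    its stability when the field changes. *)
Lemma gap_dist y s1 s2 : `|y| < r -> `|s1| <= T -> `|s2| <= T ->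
  c * `|s1 - s2| <= `|gap p u y s1 - gap p u y s2|.
Proof.
move=> yr s1T s2T.
apply: (@dist_le_increase R (gap p u y) (gap_rate p u y) c T) => //.
  by move=> tau tauT; exact: gap_derive.
by move=> tau tauT; exact: (tr_rate tr).
Qed.

Lemma gap_zero y : `|y| < r -> exists2 z : R, 2 * `|z| <= T & gap p u y z = 0.
Proof.
move=> yr; apply: (@zero_exists R (gap p u y) (gap_rate p u y) c T) => //.
- by move=> tau tauT; exact: gap_derive.
- by move=> tau tauT; exact: (tr_rate tr).
- exact: (tr_gap0 tr).
Qed.

Lemma gap_zero_uniq y z1 z2 : `|y| < r -> `|z1| <= T -> `|z2| <= T ->
  gap p u y z1 = 0 -> gap p u y z2 = 0 -> z1 = z2.
Proof.
move=> yr z1T z2T g1 g2; have := gap_dist yr z1T z2T.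
by rewrite g1 g2 subrr normr0 pmulr_rle0// normr_le0 subr_eq0 => /eqP.
Qed.

Lemma gap_at0 : gap p u 0 0 = 0.
Proof. by rewrite /gap /disp /launch scaler0 addr0 add0r subrr dot0l. Qed.

Lemma normal_ball_norm y r' : normal_ball (vfield p) u r' y -> `|y| < r'.
Proof. by move=> [_]; apply: le_lt_trans; exact: norm_le_enorm. Qed.

Lemma rescaled_poincare_exists y : normal_ball (vfield p) u r y ->
  exists w, rescaled_poincare (vfield p) (flowdom p) (flow p) t u y w.
Proof.
move=> yr.
(* [choice] needs a total function, hence the default 0 outside the ball. *)
have /choice[tau tauP] : forall z : V, exists s : R, `|z| < r ->
    2 * `|s| <= T /\ gap p u z s = 0.
  move=> z; have [zr|zr] := ltP `|z| r; last by exists 0.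
  by have [s s1 s2] := gap_zero zr; exists s.
have tauT z : `|z| < r -> `|tau z| <= T.
  by move=> zr; have [+ _] := tauP _ zr; have := normr_ge0 (tau z); lra.
have tau0 z : `|z| < r -> gap p u z (tau z) = 0.
  by move=> zr; have [] := tauP _ zr.
have [C C0 lip] := tr_lip tr.
exists (poincare_value p u y (tau y)), r, tau; split => //; split.
- exact: (tr_base tr).
- have z0 : `|0 : V| < r by rewrite normr0.
  apply: (@gap_zero_uniq 0) => //; rewrite ?normr0 ?(ltW T0)//.
  + by apply: tauT.
  + exact: tau0.
  + exact: gap_at0.
- apply: continuous_in_subspaceT => z; rewrite inE => /normal_ball_norm zr.
  apply: (proj2 (@cvgrPdist_le _ _ _ _ (nbhs_filter z) tau _)) => e e0.
  have C1 : 0 < C + 1 by rewrite ltr_wpDl.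
  near=> x.
  have xr : `|x| < r.
    by near: x; exact: (@cvgr_norm_lt _ _ _ _ (nbhs_filter z) id z).
  have xz : `|z - x| <= e * c / (C + 1).
    near: x; apply: (proj1 (@cvgrPdist_le _ _ _ _ (nbhs_filter z) id z)) => //.
    by rewrite divr_gt0// mulr_gt0.
  (* Replacing the zero value of the gap at [(z, tau z)] by that at [(x, tau x)] leaves two gaps at
     the same time [tau x], where [tr_lip] applies. *)
  have := gap_dist zr (tauT _ zr) (tauT _ xr).
  rewrite (tau0 _ zr) -(tau0 _ xr) => h.
  have := le_trans h (lip _ _ _ xr zr (tauT _ xr)); rewrite [`|x - z|]distrC.
  move: xz; rewrite ler_pdivlMr// => xz h2.
  rewrite -(ler_pM2l c0) (le_trans h2)// [leRHS]mulrC (le_trans _ xz)//.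
  by rewrite mulrC ler_wpM2l// lerDl.
- move=> z /normal_ball_norm zr; split.
    by apply: (tr_dom tr) => //; exact: tauT.
  exact: tau0.
Unshelve. all: by end_near. Qed.

(* Along the segment from [0] to [y] a continuous time correction stays in the
   interval where the zero of [gap] is unique, since that zero never exceeds
   half of its length. *)
Lemma rescaled_poincare_value y w : normal_ball (vfield p) u r y ->
  rescaled_poincare (vfield p) (flowdom p) (flow p) t u y w ->
  exists z : R, [/\ `|z| <= T, gap p u y z = 0 & w = poincare_value p u y z].
Proof.
have T34 : 3 / 4 * T <= T by move: T0; lra.
move=> yr [r' [tau [yr' [_ tau0 ctau tauP] ->]]].
exists (tau y); split => //; last by have [] := tauP _ yr'.
rewrite leNgt; apply/negP => Ty.
have seg (s : R) : 0 <= s <= 1 -> normal_ball (vfield p) u r' (s *: y) /\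
    `|s *: y| < r.
  move=> /andP[s0 s1]; split.
    split; first by rewrite dotZl (proj1 yr') mulr0.
    rewrite enormZ// (le_lt_trans _ (proj2 yr'))// ler_piMl ?sqrtr_ge0//.
  rewrite normrZ ger0_norm// (le_lt_trans _ (normal_ball_norm yr))//.
  by rewrite ler_piMl.
pose h (s : R) := `|tau (s *: y)|.
have hc : {within `[0, 1], continuous h}.
  apply/subspace_continuousP => s0 s01.
  apply: cvg_norm; have [yr0 _] := seg s0 s01.
  have /subspace_continuousP/(_ _ yr0) := ctau.
  move=> cs0 P /cs0 /= nP.
  have nP' := (@scalel_continuous _ _ y s0) _ nP.
  exact: (@filterS _ (nbhs s0) (nbhs_filter s0) _ _
    (fun s sP s01' => sP (proj1 (seg s s01'))) nP').
(* [3 / 4 * T] lies strictly between [T / 2], the bound on the zero from [gap_zero], and [T], up to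
   which uniqueness holds. A correction ending beyond [T] would take this absolute value on the
   way. *)
have [|s] := @IVT R h 0 1 (3 / 4 * T) ler01 hc.
  rewrite /h scale0r scale1r tau0 normr0 ge_min le_max; apply/andP; split.
    by rewrite mulr_ge0 ?(ltW T0).
  by apply/orP; right; exact: le_trans T34 (ltW Ty).
rewrite in_itv/= => s01 hs; have [nb sr] := seg s s01.
have [z z2 gz] := gap_zero sr.
have zT : `|z| <= T by have := normr_ge0 z; lra.
have hT : `|tau (s *: y)| <= T by rewrite -/(h s) hs.
have := gap_zero_uniq sr zT hT gz (proj2 (tauP _ nb)) => zs.
by move: z2 T0; rewrite zs -/(h s) hs; lra.
Qed.


End Fixed.
End TimeCorrection.

(** * Limits under perturbation of the field, the base point and the displacement *)

Section Perturbation.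
Context {R : realType} {d : nat} (A : 'M[R]_d).
Local Notation V := 'cV[R]_d.
Variable q : flow_data R d.
Hypothesis ql : forall del, 0 < del -> almost_linear A del q.
Hypothesis qA : forall x, vfield q x = A *m x.
Variable t : R.

(** If the orbit reached 0 at time [t], Gronwall run backwards from that time with zero initial
    value would give [u = 0]. *)
Lemma linear_flow_neq0 u : u != 0 -> flow q t u != 0.
Proof.
apply: contra_neq => qtu.
have [a a0 Aa] := mulmx_bounded 1 A.
have [del /andP[d0 _] [dt du _]] := small_inverse (2 * `|t|) `|u| 0 (@ltr01 R).
have qu : flow q (1 * - t + t) u = u by rewrite mul1r addNr (al_start (ql d0)).
pose K := d%:R * (`|0 : V| ^+ 2 + 0 ^+ 2 * `|t|) * expR (d%:R * (2 * a + 1) * `|t|).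
have K0 : K = 0 by rewrite /K normr0 !expr0n/= mul0r addr0 mulr0 mul0r.
suff : `|flow q (1 * - t + t) u| ^+ 2 <= K.
  by rewrite qu K0 le_eqVlt ltNge sqr_ge0 orbF sqrf_eq0 normr_eq0 => /eqP.
apply: (@norm_growth R d (fun s => flow q (1 * s + t) u)
  (fun s => 1 *: vfield q (flow q (1 * s + t) u)) 0 _ _ _ 1) => //.
- by rewrite mulr0 add0r.
- move=> s st; apply: (@is_derive_comp_affine _ _ _ (flow q ^~ u)).
  apply: (al_derive (ql d0)).
  apply: (al_dom (ql d0)) => //; apply: (le_trans _ dt).
  by rewrite mul1r (le_trans (ler_normD _ _))// mulr_natl mulr2n lerD2r.
- by move=> s _ _; rewrite scale1r qA addr0.
- by rewrite -/K K0 expr1n.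
- by rewrite normrN.
Qed.

Section Convergence.
Context (I : Type) (F : set_system I) (FF : Filter F).
Variables (p : I -> flow_data R d) (u y : I -> V) (tau : I -> R).
Variables (u0 y0 : V) (tau0 : R).
Hypothesis cp : p @ F --> to_linear A.
Hypothesis cu : u @ F --> u0.
Hypothesis cy : y @ F --> y0.
Hypothesis ctau : tau @ F --> tau0.

Lemma launch_cvg : launch (p i) (u i) (y i) @[i --> F] --> launch q u0 y0.
Proof.
apply: cvgD => //; apply: cvgZ => //; apply: cvg_enorm.
by rewrite qA; exact: (field_cvg FF cp cu).
Qed.

Lemma base_cvg : flow (p i) t (u i) @[i --> F] --> flow q t u0.
Proof. by apply: (flow_cvg ql qA FF cp) => //; exact: cvg_cst. Qed.

Lemma target_cvg : flow (p i) (tau i + t) (launch (p i) (u i) (y i)) @[i --> F] -->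
  flow q (tau0 + t) (launch q u0 y0).
Proof.
apply: (flow_cvg ql qA FF cp); last exact: launch_cvg.
by apply: cvgD => //; exact: cvg_cst.
Qed.

Lemma disp_cvg :
  disp t (p i) (u i) (y i) (tau i) @[i --> F] --> disp t q u0 y0 tau0.
Proof. by apply: cvgB; [exact: target_cvg|exact: base_cvg]. Qed.

Lemma base_field_cvg : vfield (p i) (flow (p i) t (u i)) @[i --> F] -->
  vfield q (flow q t u0).
Proof. by rewrite qA; apply: (field_cvg FF cp); exact: base_cvg. Qed.

Lemma gap_cvg :
  gap t (p i) (u i) (y i) (tau i) @[i --> F] --> gap t q u0 y0 tau0.
Proof. by apply: cvg_dot; [exact: disp_cvg|exact: base_field_cvg]. Qed.

Lemma gap_rate_cvg :
  gap_rate t (p i) (u i) (y i) (tau i) @[i --> F] --> gap_rate t q u0 y0 tau0.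
Proof.
apply: cvg_dot; last exact: base_field_cvg.
by rewrite [vfield q _]qA; apply: (field_cvg FF cp); exact: target_cvg.
Qed.

Lemma poincare_value_cvg : vfield q (flow q t u0) != 0 ->
  poincare_value t (p i) (u i) (y i) (tau i) @[i --> F] -->
  poincare_value t q u0 y0 tau0.
Proof.
move=> n0; apply: cvgZ; last exact: disp_cvg.
apply: cvgV; first by rewrite gt_eqF// enorm_gt0.
by apply: cvg_enorm; exact: base_field_cvg.
Qed.

End Convergence.

Section Uniform.
Variable u0 : V.
Hypothesis Au : A \in unitmx.
Hypothesis u0N0 : u0 != 0.

(** This makes the gap rate positive at [tau = 0] and the normalising factor continuous in the
    limit. *)
Lemma base_field_neq0 : vfield q (flow q t u0) != 0.
Proof.
rewrite qA; apply: contra_neq (linear_flow_neq0 u0N0) => /(congr1 (mulmx (invmx A))).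
by rewrite mulKmx// mulmx0.
Qed.

Local Notation B := (filter_prod (to_linear A) (nbhs u0)).

(** The constants are chosen in the order [c], [T], [r]: the gap at time 0 has to be small compared
    with [c T], so [y] is restricted last. *)
Lemma near_transversal : exists c T r : R, [/\ 0 < c, 0 < T, 0 < r &
  \forall i \near B, transversal t c T r i.1 i.2].
Proof.
pose F1 := filter_prod B (nbhs (0 : V)).
have FF1 : Filter F1 by exact: filter_prod_filter.
have FF2 : Filter (filter_prod F1 (nbhs (0 : R))) by exact: filter_prod_filter.
pose n := vfield q (flow q t u0).
have n0 : 0 < dot n n by apply: dot_gt0; exact: base_field_neq0.
(* At [y = 0] and [tau = 0] the rate for [q] is [dot n n]; half of it survives nearby. *)
pose c := dot n n / 2.
have c0 : 0 < c by rewrite divr_gt0.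
have cp : (fun i : _ * _ * _ => i.1.1) @ F1 --> to_linear A.
  exact: (cvg_comp _ _ cvg_fst cvg_fst).
have cu : (fun i : _ * _ * _ => i.1.2) @ F1 --> u0.
  exact: (cvg_comp _ _ cvg_fst cvg_snd).
have cy : (fun i : _ * _ * _ => i.2) @ F1 --> (0 : V) by exact: cvg_snd.
have c1 : (fun i : _ * _ => i.1) @ filter_prod F1 (nbhs (0 : R)) --> F1.
  exact: cvg_fst.
have c2 : (fun i : _ * _ => i.2) @ filter_prod F1 (nbhs (0 : R)) --> (0 : R).
  exact: cvg_snd.
have l0 : launch q u0 0 = u0 by rewrite /launch scaler0 addr0.
have [e e0 He] : exists2 e : R, 0 < e & \forall i \near F1, forall tau : R,
    `|tau - 0| < e -> c <= gap_rate t i.1.1 i.1.2 i.2 tau.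
  apply: filter_prod_ball.
  have := gap_rate_cvg FF2 (cvg_comp _ _ c1 cp) (cvg_comp _ _ c1 cu)
    (cvg_comp _ _ c1 cy) c2.
  rewrite /gap_rate l0 add0r => hc; have h := cvgr_gt _ hc c.
  apply: filterS (h FF2 _) => [[i tau] /ltW//|].
  by rewrite -/n /c ltr_pdivrMr// mulr_natr mulr2n ltrDl.
(* [e / 2] puts the closed interval inside the open one where the rate is bounded below; 1 keeps
   [tau + t] in the time span of the flow estimates. *)
pose T := Num.min (e / 2) 1.
have T0 : 0 < T by rewrite lt_min divr_gt0/=.
have Te : T < e by rewrite gt_min; apply/orP; left; lra.
have T1 : T <= 1 by rewrite ge_min lexx orbT.
have Hgap : \forall i \near F1, 2 * `|gap t i.1.1 i.1.2 i.2 0| <= c * T.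
  have ct : (fun=> 0 : R) @ F1 --> (0 : R) by exact: cvg_cst.
  have /cvg_norm := gap_cvg FF1 cp cu cy ct.
  rewrite gap_at0 normr0 => hc; have h := cvgr_le _ hc (c * T / 2).
  apply: filterS (h FF1 _) => [i|]; last by rewrite divr_gt0// mulr_gt0.
  by rewrite ler_pdivlMr// mulrC.
have Hl : \forall i \near F1, `|launch i.1.1 i.1.2 i.2| <= `|u0| + 1.
  have /cvg_norm := launch_cvg FF1 cp cu cy.
  by rewrite l0 => hc; apply: (cvgr_le _ hc); rewrite ltrDl.
have [r r0 Hr] : exists2 r : R, 0 < r & \forall i \near B, forall y : V,
    `|y - 0| < r -> [/\ `|launch i.1 i.2 y| <= `|u0| + 1,
      2 * `|gap t i.1 i.2 y 0| <= c * T &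
      forall tau : R, `|tau - 0| < e -> c <= gap_rate t i.1 i.2 y tau].
  apply: filter_prod_ball.
  suff : \forall i \near F1, [/\ `|launch i.1.1 i.1.2 i.2| <= `|u0| + 1,
      2 * `|gap t i.1.1 i.1.2 i.2 0| <= c * T &
      forall tau : R, `|tau - 0| < e -> c <= gap_rate t i.1.1 i.1.2 i.2 tau].
    by apply: filterS => [[i y]].
  near=> i; split; [by near: i|by near: i|by near: i].
exists c, T, r; split => //.
have [a a0 Aa] := mulmx_bounded 1 A.
have [C C0 Clip] := flow_lipschitz Aa a0 (`|t| + 1) (`|u0| + 1).
have [del /andP[d0 _] [dt du _]] :=
  small_inverse (`|t| + 1) (`|u0| + 1) 0 (@ltr01 R).
have cb1 : (fun i : flow_data R d * V => i.1) @ B --> to_linear A by exact: cvg_fst.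
have cb2 : (fun i : flow_data R d * V => i.2) @ B --> u0 by exact: cvg_snd.
have CB := near_along cb1 Clip.
have Hu : \forall i \near B, `|i.2| <= `|u0| + 1.
  have FB : Filter B by exact: filter_prod_filter.
  by apply: (@cvgr_norm_le _ _ _ _ FB _ u0 cb2); rewrite ltrDl.
near=> i.
have al : almost_linear A del i.1.
  by near: i; apply: (near_along cb1); exact: near_to_linear.
have Hi : forall y : V, `|y - 0| < r -> [/\ `|launch i.1 i.2 y| <= `|u0| + 1,
      2 * `|gap t i.1 i.2 y 0| <= c * T &
      forall tau : R, `|tau - 0| < e -> c <= gap_rate t i.1 i.2 y tau].
  by near: i.
have Ci : forall s x y, `|s| <= `|t| + 1 -> `|x| <= `|u0| + 1 ->
    `|y| <= `|u0| + 1 -> `|flow i.1 s x - flow i.1 s y| <= C * `|x - y|.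
  by near: i; exact: CB.
have ui : `|i.2| <= `|u0| + 1.
  by near: i.
have ttau (tau : R) : `|tau| <= T -> `|tau + t| <= `|t| + 1.
  by move=> tauT; rewrite (le_trans (ler_normD _ _))// addrC lerD2l (le_trans tauT).
split.
- by apply: (al_dom al); [apply: (le_trans _ dt); rewrite lerDl|exact: le_trans ui du].
- move=> y tau yr tauT; apply: (al_dom al).
    by rewrite (le_trans (ttau _ tauT)).
  by have [|h _ _] := Hi y; rewrite ?subr0// (le_trans h).
- move=> y tau yr tauT; have [|_ _] := Hi y; first by rewrite subr0.
  by apply; rewrite subr0 (le_lt_trans tauT).
- by move=> y yr; have [|] := Hi y; first by rewrite subr0.
- pose n1 := vfield i.1 (flow i.1 t i.2).
  have E0 : 0 <= enorm (vfield i.1 i.2) by exact: sqrtr_ge0.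
  (* This constant varies with [i], which suffices: [tr_lip] serves continuity in [y] for one field
     at a time. *)
  exists (d%:R * (C * enorm (vfield i.1 i.2) * `|n1|)).
    by rewrite !mulr_ge0.
  move=> y1 y2 tau y1r y2r tauT; rewrite /gap -dotBl /disp opprB addrA subrK.
  rewrite (le_trans (dot_le _ _))// -mulrA ler_wpM2l//.
  rewrite mulrAC ler_wpM2r//.
  have [|h1 _ _] := Hi y1; first by rewrite subr0.
  have [|h2 _ _] := Hi y2; first by rewrite subr0.
  rewrite (le_trans (Ci _ _ _ (ttau _ tauT) h1 h2))//.
  rewrite -mulrA ler_wpM2l// /launch opprD addrACA subrr add0r -scalerBr.
  by rewrite normrZ ger0_norm.
Unshelve. all: by end_near. Qed.

(** The gap of the perturbed field at the limiting zero [z] tends to 0, and [gap_dist] turns this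
    into closeness of the perturbed zero to [z]. The value [v] is computed from [q], [t], [u0] and
    [y0] alone. *)
Lemma poincare_stable : exists2 r : R, 0 < r &
  forall y0, dot y0 (A *m u0) = 0 -> enorm y0 < r ->
  exists v, forall e : R, 0 < e -> \forall i \near filter_prod B (nbhs y0),
    let p := i.1.1 in let u := i.1.2 in let y := i.2 in
    dot y (vfield p u) = 0 ->
    (exists w, rescaled_poincare (vfield p) (flowdom p) (flow p) t u y w) /\
    (forall w, rescaled_poincare (vfield p) (flowdom p) (flow p) t u y w ->
       enorm (w - v) < e).
Proof.
have [c [T [r [c0 T0 r0 Htr]]]] := near_transversal.
exists r => // y0 y0u y0r.
pose F := filter_prod B (nbhs y0).
have FF : Filter F by exact: filter_prod_filter.
have FF2 (z : R) : Filter (filter_prod F (nbhs z)) by exact: filter_prod_filter.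
have qtr : transversal t c T r q u0.
  move: Htr => [[P1 P2] /= [HP1 HP2]] /(_ (q, u0)); apply; split => /=.
    exact: (near_to_linear_self ql).
  exact: nbhs_singleton.
have y0r' : `|y0| < r by exact: le_lt_trans (norm_le_enorm _) y0r.
have [z z2 gz] := gap_zero (ql ltr01) T0 qtr y0r'.
have zT : `|z| <= T by have := normr_ge0 z; lra.
exists (poincare_value t q u0 y0 z) => e e0.
have cp : (fun i : _ * _ * _ => i.1.1) @ F --> to_linear A.
  exact: (cvg_comp _ _ cvg_fst cvg_fst).
have cu : (fun i : _ * _ * _ => i.1.2) @ F --> u0.
  exact: (cvg_comp _ _ cvg_fst cvg_snd).
have cb : (fun i : _ * _ * _ => i.1) @ F --> B by exact: cvg_fst.
have cy : (fun i : _ * _ * _ => i.2) @ F --> y0 by exact: cvg_snd.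
have c1 : (fun i : _ * _ => i.1) @ filter_prod F (nbhs z) --> F by exact: cvg_fst.
have c2 : (fun i : _ * _ => i.2) @ filter_prod F (nbhs z) --> z by exact: cvg_snd.
have [e1 e10 He1] : exists2 e1 : R, 0 < e1 & \forall i \near F, forall s : R,
    `|s - z| < e1 ->
    enorm (poincare_value t i.1.1 i.1.2 i.2 s - poincare_value t q u0 y0 z) < e.
  apply: filter_prod_ball.
  have pc := poincare_value_cvg (FF2 z) (cvg_comp _ _ c1 cp) (cvg_comp _ _ c1 cu)
    (cvg_comp _ _ c1 cy) c2 base_field_neq0.
  have := cvg_enorm (FF2 z) (@cvgB _ _ _ _ (FF2 z) _ _ _ _ pc
    (@cvg_cst _ (poincare_value t q u0 y0 z) _ _ (FF2 z))).
  rewrite subrr enorm0 => hc.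
  by apply: (@filterS _ _ (FF2 z) _ _ _ (cvgr_lt _ hc _ e0)) => [[i s]].
(* The threshold [c * e1] is what [gap_dist] converts into a distance [e1] between zeros. *)
have Hg : \forall i \near F, `|gap t i.1.1 i.1.2 i.2 z| < c * e1.
  have ct : (fun=> z) @ F --> z by exact: cvg_cst.
  have /cvg_norm := gap_cvg FF cp cu cy ct.
  by rewrite gz normr0 => hc; apply: (cvgr_lt _ hc); rewrite mulr_gt0.
have HtrF : \forall i \near F, transversal t c T r i.1.1 i.1.2 by exact: cb Htr.
have Hy : \forall i \near F, enorm i.2 < r.
  exact: (cvgr_lt _ (cvg_enorm FF cy)).
near=> i.
have tr : transversal t c T r i.1.1 i.1.2 by near: i; exact: HtrF.
have al : almost_linear A 1 i.1.1.
  by near: i; apply: (near_along cp); exact: near_to_linear.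
have yr : enorm i.2 < r.
  by near: i; exact: Hy.
have close : forall s : R, `|s - z| < e1 ->
    enorm (poincare_value t i.1.1 i.1.2 i.2 s - poincare_value t q u0 y0 z) < e.
  by near: i.
have gi : `|gap t i.1.1 i.1.2 i.2 z| < c * e1 by near: i.
move: tr al yr close gi; rewrite /=.
set p := i.1.1; set u := i.1.2; set y := i.2 => tr al yr close gi yu.
have nb : normal_ball (vfield p) u r y by split.
split; first exact: (rescaled_poincare_exists al c0 T0 r0 tr nb).
move=> w /(rescaled_poincare_value al c0 T0 tr nb)[s [sT gs ->]].
have := gap_dist al tr (normal_ball_norm nb) sT zT.
rewrite gs sub0r normrN => h; apply: close.
by rewrite -(ltr_pM2l c0) (le_lt_trans h).
Unshelve. all: by end_near. Qed.

End Uniform.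
End Perturbation.

(** * Rescaling at the singularity *)

Section LocalLipschitz.
Context {R : realType} {d : nat}.
Local Notation V := 'cV[R]_d.

Lemma is_derive_along_line (f : V -> V) (x v : V) (h : R) :
  derivable f (h *: v + x) v ->
  is_derive h 1 (fun s => f (s *: v + x)) ('D_v f (h *: v + x)).
Proof.
move=> df.
have E : (fun k : R => k^-1 *: (((fun s => f (s *: v + x)) \o shift h) (k *: (1 : R))
      - f (h *: v + x))) =
    (fun k : R => k^-1 *: ((f \o shift (h *: v + x)) (k *: v) - f (h *: v + x))).
  apply/funext => k /=; congr (_ *: (f _ - _)).
  by rewrite [k *: 1]mulr1 scalerDl addrA.
by apply: DeriveDef; rewrite /derivable /derive E.
Qed.

(** The partial derivatives of [X] are continuous and agree at 0 with those of [A], so the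
    derivative of [X - A] is small near 0; the mean value theorem along the segment from [y] to [x],
    entry by entry, gives the bound. *)
Lemma C1_lipschitz_near0 (A : 'M[R]_d) (f X : V -> V) :
  (forall x, X x = A *m x + f x) -> C1 X -> is_diff (0 : V) f (cst 0) ->
  forall eta : R, 0 < eta -> exists2 rho : R, 0 < rho &
    forall x y, `|x| < rho -> `|y| < rho ->
      `|(X x - A *m x) - (X y - A *m y)| <= eta * `|x - y|.
Proof.
move=> XE [dX cX] df0 eta eta0.
have linX z v : 'D_v X z = \sum_j v j 0 *: 'D_(delta_mx j 0) X z.
  rewrite {1}[v]matrix_sum_delta exchange_big big_ord1 deriveE// linear_sum.
  by apply: eq_bigr => j _; rewrite linearZ deriveE.
have linA (v : V) : A *m v = \sum_j v j 0 *: (A *m delta_mx j 0).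
  rewrite {1}[v]matrix_sum_delta exchange_big big_ord1 mulmx_sumr.
  by apply: eq_bigr => j _; rewrite scalemxAr.
have dA (v x : V) : is_derive x v (mulmx A) (A *m v).
  apply/is_derive_mxP => i j.
  have -> : (fun z : V => (A *m z) i j) = \sum_k (A i k \*: (fun z : V => z k j)).
    by apply/funext => z; rewrite mxE fct_sumE.
  have dz k : is_derive x v (fun z : V => z k j) (v k j).
    exact: ((is_derive_mxP _ _ _ _).1 (is_derive_id x v)).
  by apply: is_derive_eq; rewrite mxE.
have D0 v : 'D_v X 0 = A *m v.
  have -> : X = mulmx A + f by apply/funext => x; rewrite XE.
  have df : is_derive (0 : V) v f 0.
    by apply: DeriveDef; [exact: diff_derivable|rewrite deriveE// diff_val].
  by rewrite derive_val addr0.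
(* A directional derivative sums [d] partial ones, each within [k]; the [+ 1] covers [d = 0]. *)
pose k := eta / (d%:R + 1).
have k0 : 0 < k by rewrite divr_gt0// ltr_wpDl.
have kd : d%:R * k <= eta.
  by rewrite /k mulrCA ler_piMr ?(ltW eta0)// ler_pdivrMr ?mul1r ?lerDl// ltr_wpDl.
have near0 : \forall z \near (0 : V), forall j,
    `|'D_(delta_mx j 0) X z - A *m delta_mx j 0| <= k.
  apply: (@filter_forall _ _ _ _ (nbhs_filter (0 : V))) => j.
  have /cvgrPdist_le/(_ k k0) := cX (delta_mx j 0) 0.
  by apply: filterS => z; rewrite D0 distrC.
have [rho /= rho0 Hrho] := (proj1 (nbhs_normP _ _) near0).
exists rho => // x y xr yr.
have Dsmall z v : `|z| < rho -> `|'D_v X z - A *m v| <= eta * `|v|.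
  move=> zr; rewrite linX linA -sumrB.
  rewrite (le_trans (ler_norm_sum _ _ _))//.
  rewrite (le_trans (ler_sum _ (G := fun=> k * `|v|) _))//.
    move=> j _; rewrite -scalerBr normrZ mulrC ler_pM// ?coord_le_norm//.
    by apply: Hrho; rewrite /= sub0r normrN.
  by rewrite sumr_const card_ord -mulr_natl mulrA ler_wpM2r.
pose v := x - y; pose h (s : R) := X (s *: v + y) - A *m (s *: v + y).
have dh (s : R) : is_derive s 1 h ('D_v X (s *: v + y) - A *m v).
  have d1 : is_derive s 1 (fun s => X (s *: v + y)) ('D_v X (s *: v + y)).
    by apply: is_derive_along_line; exact: diff_derivable.
  have d2 : is_derive s 1 (fun s => A *m (s *: v + y)) (A *m v).
    have dAl := dA v (s *: v + y).
    by have := @is_derive_along_line (mulmx A) y v s; rewrite derive_val; apply.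
  exact: is_deriveB.
have in_ball (s : R) : 0 <= s <= 1 -> `|s *: v + y| < rho.
  move=> /andP[s0 s1]; have -> : s *: v + y = s *: x + (1 - s) *: y.
    by rewrite /v scalerBr scalerBl scale1r addrAC addrA.
  apply: (@le_lt_trans _ _ (s * `|x| + (1 - s) * `|y|)).
    by rewrite (le_trans (ler_normD _ _))// !normrZ !ger0_norm ?subr_ge0.
  have m1 : `|x| <= Num.max `|x| `|y| by rewrite le_max lexx.
  have m2 : `|y| <= Num.max `|x| `|y| by rewrite le_max lexx orbT.
  apply: (@le_lt_trans _ _ (Num.max `|x| `|y|)); last by rewrite gt_max xr.
  have := ler_wpM2l s0 m1; have := ler_wpM2l (_ : 0 <= 1 - s) m2.
  rewrite subr_ge0 => /(_ s1); lra.
have h1 : h 1 = X x - A *m x by rewrite /h scale1r /v subrK.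
have h0 : h 0 = X y - A *m y by rewrite /h scale0r add0r.
rewrite -h1 -h0; apply: norm_le_coord => [|i j]; first by rewrite mulr_ge0// ltW.
have dij (s : R) : is_derive s 1 (fun s => h s i j) (('D_v X (s *: v + y) - A *m v) i j).
  exact: ((is_derive_mxP _ _ _ _).1 (dh s)).
have [|s s01] := @MVT_segment R (fun s => h s i j)
  (fun s => ('D_v X (s *: v + y) - A *m v) i j) 0 1 ler01 (fun s _ => dij s).
  by apply: derivable_within_continuous => s _; have [] := dij s.
rewrite subr0 mulr1 => hs.
have -> : (h 1 - h 0) i j = h 1 i j - h 0 i j by rewrite mxE [X in _ + X]mxE.
rewrite hs; apply: (le_trans (coord_le_norm _ i j)); apply: Dsmall.
by apply: in_ball; move: s01; rewrite in_itv.
Qed.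

End LocalLipschitz.

Section Rescaling.
Context {R : realType} {d : nat}.
Local Notation V := 'cV[R]_d.
Variables (X : V -> V) (D : set (R * V)) (phi : R -> V -> V).

Definition rescale (s : R) : flow_data R d :=
  FlowData (fun x => s^-1 *: X (s *: x)) [set z | D (z.1, s *: z.2)]
    (fun t x => s^-1 *: phi t (s *: x)).

Lemma normal_ball_rescale s u r : 0 < s ->
  normal_ball (vfield (rescale s)) u r = normal_ball X (s *: u) r.
Proof.
move=> s0; apply/seteqP; split=> y [yX yr]; split=> //.
  move: yX; rewrite /= dotZr => /eqP; rewrite mulf_eq0 invr_eq0 gt_eqF//=.
  by move=> /eqP.
by rewrite /= dotZr yX mulr0.
Qed.

(** Exact for every positive [s]: the homothety leaves time unscaled, so [tau] and [r] are the same
    on both sides, and [s] cancels between displacement and speed. *)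
Lemma rescaled_poincare_rescale s t u y w : 0 < s ->
  rescaled_poincare X D phi t (s *: u) y w <->
  rescaled_poincare (vfield (rescale s)) (flowdom (rescale s))
    (flow (rescale s)) t u y w.
Proof.
move=> s0; have sN0 : s != 0 by rewrite gt_eqF.
have si0 : 0 <= s^-1 by rewrite invr_ge0 ltW.
have launchE z : s *: (u + enorm (s^-1 *: X (s *: u)) *: z) =
    s *: u + enorm (X (s *: u)) *: z.
  by rewrite enormZ// scalerDr scalerA mulrA mulfV// mul1r.
have phiE : s *: (s^-1 *: phi t (s *: u)) = phi t (s *: u).
  by rewrite scalerA mulfV// scale1r.
have tcE r tau : time_correction X D phi t (s *: u) r tau <->
    time_correction (vfield (rescale s)) (flowdom (rescale s))
      (flow (rescale s)) t u r tau.
  split=> -[Dt tau0 ctau tauP]; split=> //.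
  - by rewrite normal_ball_rescale.
  - move=> z; rewrite normal_ball_rescale// => /tauP[Dz gz]; split => /=.
      by rewrite launchE.
    by rewrite launchE phiE -scalerBr dotZl dotZr gz !mulr0.
  - by rewrite -normal_ball_rescale.
  - move=> z; rewrite -normal_ball_rescale// => /tauP[/= Dz gz]; split => /=.
      by rewrite -launchE.
    move: gz; rewrite launchE phiE -scalerBr dotZl dotZr => /eqP.
    by rewrite !mulf_eq0 !invr_eq0 (negPf sN0)/= => /eqP.
have valE z : (enorm (s^-1 *: X (s *: (s^-1 *: phi t (s *: u)))))^-1 *:
      (s^-1 *: z) = (enorm (X (phi t (s *: u))))^-1 *: z.
  by rewrite phiE enormZ// invfM invrK scalerA -mulrA mulrCA mulfV// mulr1.
split=> -[r [tau [yr tc ->]]]; exists r, tau; split.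
- by rewrite normal_ball_rescale.
- exact/tcE.
- by rewrite /= launchE -scalerBr valE.
- by rewrite -normal_ball_rescale.
- exact/tcE.
- by rewrite /= launchE -scalerBr valE.
Qed.

Hypothesis XDphi : flow_of X D phi.
Hypothesis X0 : X 0 = 0.

(** The constant solution at 0 exists for all times, so maximality puts these times in the
    domain. *)
Lemma flowdom_fixpoint t : D (t, 0).
Proof.
have h (s : R) : [set: R] s -> is_derive s 1 (cst (0 : V)) (X (cst 0 s)).
  by move=> _; rewrite /= X0; exact: is_derive_cst.
have iT : is_interval [set: R] by [].
by have [] := flow_maximal XDphi openT iT I h (I : [set: R] t).
Qed.

Lemma flowdom_near0 t : exists2 e : R, 0 < e & forall x, `|x| < e -> D (t, x).
Proof.
have : nbhs (t, 0 : V) D.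
  by apply: open_nbhs_nbhs; split; [exact: flow_open XDphi|exact: flowdom_fixpoint].
move=> [[P Q] /= [Pt /nbhs_normP[e /= e0 eQ]] PQ]; exists e => // x xe.
apply: (PQ (t, x)); split => /=; first exact: nbhs_singleton.
by apply: eQ; rewrite /= sub0r normrN.
Qed.

(** Time domains are intervals, so it is enough to control the endpoints [T] and [- T]. *)
Lemma flowdom_interval_near0 T : exists2 e : R, 0 < e &
  forall t x, `|t| <= T -> `|x| < e -> D (t, x).
Proof.
have [e1 e10 h1] := flowdom_near0 T; have [e2 e20 h2] := flowdom_near0 (- T).
exists (Num.min e1 e2) => [|t x tT]; first by rewrite lt_min e10.
rewrite lt_min => /andP[/h1 DT /h2 DNT].
by apply: (flow_interval XDphi DNT DT); rewrite -ler_norml.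
Qed.

Lemma rescale_almost_linear (A : 'M[R]_d) :
  (forall eta : R, 0 < eta -> exists2 rho : R, 0 < rho &
    forall x y, `|x| < rho -> `|y| < rho ->
      `|(X x - A *m x) - (X y - A *m y)| <= eta * `|x - y|) ->
  forall del : R, 0 < del -> exists2 s0 : R, 0 < s0 &
    forall s, 0 < s < s0 -> almost_linear A del (rescale s).
Proof.
move=> lip del del0; have [rho rho0 lipdel] := lip _ del0.
have [e e0 De] := flowdom_interval_near0 del^-1.
(* The homothety maps the ball of radius [del^-1] into that of radius [s / del], which is below both
   [rho] and [e]. *)
exists (Num.min rho e * del) => [|s /andP[s0]].
  by rewrite mulr_gt0// lt_min rho0.
rewrite -ltr_pdivrMr// lt_min => /andP[srho se].
have sN0 : s != 0 by rewrite gt_eqF.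
have small (x : V) : `|x| <= del^-1 -> `|s *: x| <= s / del.
  by move=> xd; rewrite normrZ gtr0_norm// ler_wpM2l// ltW.
split=> /=.
- by rewrite scaler0 X0 scaler0.
- move=> x y /small xs /small ys.
  have -> : s^-1 *: X (s *: x) - A *m x - (s^-1 *: X (s *: y) - A *m y) =
      s^-1 *: ((X (s *: x) - A *m (s *: x)) - (X (s *: y) - A *m (s *: y))).
    by rewrite -!scalemxAr !scalerBr !scalerA mulVf// !scale1r.
  rewrite normrZ gtr0_norm ?invr_gt0// ler_pdivrMl// mulrCA.
  rewrite (le_trans (lipdel _ _ (le_lt_trans xs srho) (le_lt_trans ys srho)))//.
  by rewrite -scalerBr normrZ gtr0_norm.
- by move=> x; rewrite (proj2 (flow_start XDphi _)) scalerA mulVf// scale1r.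
- move=> t x /= Dtx; rewrite scalerA mulfV// scale1r.
  have := flow_derive XDphi Dtx; exact: is_deriveZ.
- by move=> t x td /small xs; apply: De => //; exact: le_lt_trans xs se.
Qed.

End Rescaling.

Section LinearFlowTotal.
Context {R : realType} {d : nat} (A : 'M[R]_d).
Local Notation V := 'cV[R]_d.
Variables (D : set (R * V)) (phi : R -> V -> V).
Hypothesis flowA : flow_of (mulmx A) D phi.

(** An orbit starting close enough to 0 lasts until [t]; by linearity, scaling it up gives a
    solution from [x], and maximality concludes. *)
Lemma linear_flow_total t x : D (t, x).
Proof.
have [e e0 De] := flowdom_near0 flowA (mulmx0 _ A) t.
have x1 : 0 < `|x| + 1 by rewrite ltr_wpDl.
pose s := e / (`|x| + 1).
have s0 : 0 < s by rewrite divr_gt0.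
have sN0 : s != 0 by rewrite gt_eqF.
have sx : `|s *: x| < e.
  rewrite normrZ gtr0_norm//; have : s * (`|x| + 1) = e by rewrite divfK ?gt_eqF.
  by move=> <-; rewrite mulrDr mulr1 ltrDl.
pose c tau := s^-1 *: phi tau (s *: x).
pose J : set R := [set tau | D (tau, s *: x)].
have oJ : open J.
  apply: (@open_comp _ _ (fun tau : R => (tau, s *: x))); last exact: flow_open flowA.
  move=> tau _; exact: (@cvg_pair _ _ _ _ (nbhs tau) (nbhs (s *: x)) (nbhs_filter tau)
    (nbhs_filter tau) (nbhs_filter (s *: x)) id (fun=> s *: x) cvg_id
    (@cvg_cst _ (s *: x) _ _ (nbhs_filter tau))).
have iJ : is_interval J by exact: (flow_interval flowA (x := s *: x)).
have J0 : J 0 by have [] := flow_start flowA (s *: x).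
have dc (tau : R) : J tau -> is_derive tau 1 c (A *m c tau).
  move=> Jtau; rewrite /c -scalemxAr.
  by have := flow_derive flowA Jtau; exact: is_deriveZ.
have [] := flow_maximal flowA oJ iJ J0 dc (De _ sx : J t).
by rewrite /c (proj2 (flow_start flowA _)) scalerA mulVf// scale1r.
Qed.

Lemma linear_flow_almost_linear del : 0 < del ->
  almost_linear A del (FlowData (mulmx A) D phi).
Proof.
move=> d0; split => /=.
- by rewrite mulmx0.
- by move=> x y _ _; rewrite !subrr normr0 mulr_ge0// ltW.
- by move=> x; have [] := flow_start flowA x.
- by move=> t x; exact: flow_derive.
- by move=> t x _ _; exact: linear_flow_total.
Qed.

End LinearFlowTotal.

(** The limit [v] is a parameter, and [X] enters through its flow and the Lipschitz estimate, so the
    same stable [v] can be fed in for two fields. *)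
Lemma extended_poincare_of_stable (R : realType) (d : nat) (A : 'M[R]_d)
    (X : 'cV[R]_d -> 'cV[R]_d) (D : set (R * 'cV[R]_d))
    (phi : R -> 'cV[R]_d -> 'cV[R]_d) (t : R) (u0 y0 v : 'cV[R]_d) :
  flow_of X D phi -> X 0 = 0 ->
  (forall eta : R, 0 < eta -> exists2 rho : R, 0 < rho &
    forall x y, `|x| < rho -> `|y| < rho ->
      `|(X x - A *m x) - (X y - A *m y)| <= eta * `|x - y|) ->
  (forall e : R, 0 < e ->
    \forall i \near filter_prod (filter_prod (to_linear A) (nbhs u0)) (nbhs y0),
    let p := i.1.1 in let u := i.1.2 in let y := i.2 in
    dot y (vfield p u) = 0 ->
    (exists w, rescaled_poincare (vfield p) (flowdom p) (flow p) t u y w) /\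
    (forall w, rescaled_poincare (vfield p) (flowdom p) (flow p) t u y w ->
       enorm (w - v) < e)) ->
  extended_poincare X D phi t u0 y0 v.
Proof.
move=> XDphi X0 lip stable e /stable[[P Q] /=].
move=> [[[P1 P2] /= [[del /= del0 P1P] /nbhs_normP[e2 /= e20 P2P]] PP]].
move=> /nbhs_normP[e3 /= e30 QP] PQ.
have [s0 s00 Hs] := rescale_almost_linear XDphi X0 lip del0.
exists (Num.min s0 (Num.min e2 e3)); first by rewrite !lt_min s00 e20.
move=> s u' y' /andP[sgt0]; rewrite !lt_min => /andP[ss0 _] _.
move=> /and3P[_ u'e _] y'n /and3P[_ _ y'e].
have close_norm (x z : 'cV[R]_d) (b : R) : enorm (x - z) < b -> `|z - x| < b.
  by rewrite distrC; apply: le_lt_trans; exact: norm_le_enorm.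
have Pi : P (rescale X D phi s, u').
  by apply: PP; split => /=; [apply/P1P/Hs/andP|apply/P2P/close_norm].
have Qi : Q y' by apply/QP/close_norm.
have [|[w ww] uniq_w] := PQ ((rescale X D phi s, u'), y') (conj Pi Qi).
  by rewrite /= dotZr y'n mulr0.
split; first by exists w; apply/(rescaled_poincare_rescale _ _ _ _ _ _ _ sgt0).
by move=> w' /(rescaled_poincare_rescale _ _ _ _ _ _ _ sgt0)/uniq_w.
Qed.

(** A square [B] with orthonormal columns is invertible, so [A] is conjugate to [L]. The width is a
    separate [n] because the sum of the block widths equals [d] only up to a proof. *)
Lemma frame_unitmx (R : realType) (d n : nat) (A : 'M[R]_d) (B : 'M[R]_(d, n))
    (L : 'M[R]_n) :
  n = d -> orthonormal_frame B -> A *m B = B *m L -> L \in unitmx ->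
  A \in unitmx.
Proof.
move=> nd; rewrite -nd in A B * => frameB AB Lu.
have Bu : B \in unitmx by have [] := mulmx1_unit frameB.
have : A *m B \in unitmx by rewrite AB unitmx_mul Bu.
by rewrite unitmx_mul => /andP[].
Qed.

Theorem lemma3p6 (R : realType) (d i : nat) (lambda : nat -> R)
    (Bss : 'M[R]_(d, i.-1)) (bcs bcu : 'cV[R]_d) (Buu : 'M[R]_(d, d - i.+1))
    (Ass : 'M[R]_(i.-1)) (Auu : 'M[R]_(d - i.+1)) (A : 'M[R]_d)
    (f : 'cV[R]_d -> 'cV[R]_d)
    (DX DY : set (R * 'cV[R]_d)) (phiX phiY : R -> 'cV[R]_d -> 'cV[R]_d)
    (X := fun x : 'cV[R]_d => A *m x + f x)
    (Y := fun x : 'cV[R]_d => A *m x) :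
  (0 < i < d)%N ->
  (* Lyapunov exponents lambda 1 <= ... <= lambda d *)
  (forall j k : nat, (0 < j)%N -> (j <= k)%N -> (k <= d)%N ->
     lambda j <= lambda k) ->
  lambda i < 0 -> 0 < lambda i.+1 ->
  lyapunov_exponents Ass [seq lambda j | j <- iota 1 i.-1] ->
  lyapunov_exponents Auu [seq lambda j | j <- iota i.+2 (d - i.+1)] ->
  (* orthogonal decomposition E^ss + E^cs + E^cu + E^uu of R^d *)
  orthonormal_frame (row_mx Bss (row_mx bcs (row_mx bcu Buu))) ->
  (* A = (A^ss, lambda_i, lambda_{i+1}, A^uu) in this decomposition *)
  Ass \in unitmx -> Auu \in unitmx ->
  A *m Bss = Bss *m Ass ->
  A *m bcs = lambda i *: bcs ->
  A *m bcu = lambda i.+1 *: bcu ->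
  A *m Buu = Buu *m Auu ->
  (* X = A + f is C^1 with f 0 = 0 and Df(0) = 0 *)
  C1 X -> f 0 = 0 -> is_diff (0 : 'cV[R]_d) f (cst 0) ->
  flow_of X DX phiX -> flow_of Y DY phiY ->
  forall (t : R) (u : 'cV[R]_d), enorm u = 1 ->
  exists2 r : R, 0 < r &
    forall y : 'cV[R]_d, dot y (A *m u) = 0 -> enorm y < r ->
    exists v : 'cV[R]_d,
      extended_poincare X DX phiX t u y v /\
      extended_poincare Y DY phiY t u y v.
Proof.
move=> /andP[i0 id] _ li0 li1 _ _ frame Assu Auuu ABss Abcs Abcu ABuu C1X f0 df0
  flowX flowY t u u1.
have Au : A \in unitmx.
  (* [L] is the matrix of [A] in the frame; its determinant is the product of those of the four
     blocks, none of which vanishes. *)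
  pose L : 'M[R]_(i.-1 + (1 + (1 + (d - i.+1)))) :=
    block_mx Ass 0 0 (block_mx (lambda i)%:M 0 0
      (block_mx (lambda i.+1)%:M 0 0 Auu)).
  apply: (frame_unitmx (L := L) _ frame).
  - by rewrite !add1n addnS addnS -addSn prednK// -addSn subnKC.
  - rewrite /L !mul_mx_row !mul_row_block !mulmx0 !addr0 !add0r.
    by rewrite !mul_mx_scalar ABss Abcs Abcu ABuu.
  - rewrite unitmxE !det_ublock !det_scalar1 !unitrM -!unitmxE Assu Auuu !unitfE.
    by rewrite (lt_eqF li0) (gt_eqF li1).
have uN0 : u != 0.
  by apply/eqP => u0; move: u1; rewrite u0 enorm0 => /eqP; rewrite eq_sym oner_eq0.
have [r r0 stable] := poincare_stable (linear_flow_almost_linear flowY)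
  (fun=> erefl) t Au uN0.
exists r => // y yn yr; have [v stable_v] := stable y yn yr.
exists v; split.
  apply: (extended_poincare_of_stable flowX _ _ stable_v).
    by rewrite /X mulmx0 f0 addr0.
  by apply: (C1_lipschitz_near0 (f := f)).
apply: (extended_poincare_of_stable flowY _ _ stable_v); first by rewrite /Y mulmx0.
move=> eta eta0; exists 1 => // x z _ _.
by rewrite !subrr normr0 mulr_ge0// ltW.
Qed.
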